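(* Let $I=[0,1]$ and, for $1\le p\le\infty$, let $AC_p$ be the set of absolutely continuous $f:I\to\mathbb{C}$ with $f(0)=0$ and $f'\in L^p(I)$, equipped with pointwise operations and the norm $|||f|||=\|f'\|_p$. Then: (i) for every $1\le p\le\infty$, $AC_p$ is a Banach subalgebra of $C(I)$ (that is, it is a subalgebra of $C(I)$ which is a Banach algebra under $|||\cdot|||$); (ii) for every $1\le p<\infty$, $AC_p$ has an approximate identity; (iii) $AC_\infty$ has no approximate identity; (iv) for every $1\le p\le\infty$, the maximal ideal space $\triangle(AC_p)$ of $AC_p$ is homeomorphic to $(0,1]$; (v) $AC_r\subseteq AC_p$ whenever $1\le p<r\le\infty$.
   Context: $C(I)$ is the algebra of continuous complex-valued functions on $I=[0,1]$ with pointwise operations. ''Banach algebra'' is meant in the sense of a complex algebra that is complete in its norm and whose multiplication is bounded, i.e. $|||fg|||\le C\,|||f|||\,|||g|||$ for some constant $C$ (not necessarily $C=1$); no unit is required. An approximate identity for a commutative Banach algebra $A$ is a net $(e_\alpha)$ in $A$ with $\|e_\alpha g-g\|\to 0$ for each $g\in A$; it is not required to be bounded. The maximal ideal space $\triangle(A)$ is the set of nonzero multiplicative linear functionals on $A$ with the Gelfand (weak-$*$) topology; $(0,1]$ carries its usual topology. *)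

(* Defs.v *)
From HB Require Import structures.
From mathcomp Require Import all_boot all_order all_algebra.
From mathcomp Require Import all_classical all_reals all_analysis.
From mathcomp Require Import complex.
Set Implicit Arguments.
Unset Strict Implicit.
Unset Printing Implicit Defensive.
Import Order.TTheory GRing.Theory Num.Theory.
Import numFieldNormedType.Exports.
Local Open Scope classical_set_scope.
Local Open Scope ring_scope.

(* The complex numbers over R; the regular-module alias [^o] is what carries
   the topology in MathComp-Analysis.  The modulus [Normc.normc z] is
   real-valued, unlike [`|z|]. *)
Notation Cplx R := (R[i]^o).

Definition homeomorphic (X Y : topologicalType) : Prop :=
  exists (f : X -> Y) (g : Y -> X),
    [/\ cancel f g, cancel g f, continuous f & continuous g].

Section FunctionAlgebras.
Context {R : realType} {X : Type}.
Implicit Types (A B : set (X -> Cplx R)) (N : (X -> Cplx R) -> R).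

Definition is_subalgebra A B : Prop :=
  [/\ A `<=` B,
      A 0,
      forall f g, A f -> A g -> A (f + g),
      forall (c : R[i]) f, A f -> A (c *: f)
    & forall f g, A f -> A g -> A (f * g)].

Definition is_norm A N : Prop :=
  [/\ forall f, A f -> 0 <= N f,
      forall f, A f -> N f = 0 -> f = 0,
      forall (c : R[i]) f, A f -> N (c *: f) = Normc.normc c * N f
    & forall f g, A f -> A g -> N (f + g) <= N f + N g].

Definition is_complete A N : Prop :=
  forall u : nat -> X -> Cplx R,
    (forall n, A (u n)) ->
    (forall eps : R, 0 < eps ->
       exists n0, forall m n, (n0 <= m)%N -> (n0 <= n)%N ->
         N (u m - u n) < eps) ->
    exists2 l, A l & N (u n - l) @[n --> \oo] --> (0 : R).

Definition is_banach_subalgebra A B N : Prop :=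
  [/\ is_subalgebra A B, is_norm A N, is_complete A N
    & exists K : R, forall f g, A f -> A g -> N (f * g) <= K * N f * N g].

Definition is_directed (D : Type) (le : D -> D -> Prop) : Prop :=
  [/\ inhabited D,
      forall a, le a a,
      forall a b c, le a b -> le b c -> le a c
    & forall a b, exists c, le a c /\ le b c].

Definition has_approximate_identity A N : Prop :=
  exists (D : Type) (le : D -> D -> Prop) (e : D -> X -> Cplx R),
    [/\ is_directed le,
        forall a, A (e a)
      & forall g, A g -> forall eps : R, 0 < eps ->
          exists a0, forall a, le a0 a -> N (e a * g - g) < eps].

(* The type [A] is only a subtype of the functions on X, so sums, multiples and
   products of its elements are named through their values.  The Gelfand
   topology is induced by the topology of pointwise convergence on A. *)
Definition max_ideal_space A : set {ptws A -> Cplx R} :=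
  [set phi |
    [/\ exists f : A, phi f <> 0,
        forall f g h : A, \val h = \val f + \val g -> phi h = phi f + phi g,
        forall (c : R[i]) (f h : A), \val h = c *: \val f -> phi h = c * phi f
      & forall f g h : A, \val h = \val f * \val g -> phi h = phi f * phi g]].

End FunctionAlgebras.

Arguments max_ideal_space {R X} A.

Definition continuous_functions {R : realType} (X : topologicalType) :
  set (X -> Cplx R) := [set f | continuous f].

Arguments continuous_functions {R} X.

Section AbsolutelyContinuous.
Variable R : realType.

Definition Icc01 : set R := `[0, 1].
Definition Ioc01 : set R := `]0, 1].

Implicit Types (f : Icc01 -> Cplx R) (p : \bar R).

Definition lebesgue01 : {measure set (measurableTypeR R) -> \bar R} :=
  mrestr lebesgue_measure (measurable_itv `[0 : R, 1]).

Definition abs_continuous f : Prop :=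
  forall eps : R, 0 < eps -> exists2 delta : R, 0 < delta &
    forall (n : nat) (a b : 'I_n -> Icc01),
      (forall i, \val (a i) <= \val (b i)) ->
      trivIset [set: 'I_n] (fun i => `]val (a i), val (b i)[%classic) ->
      \sum_(i < n) (\val (b i) - \val (a i)) < delta ->
      \sum_(i < n) Normc.normc (f (b i) - f (a i)) < eps.

(* Derivative taken coordinatewise in C = R^2.  The extension of f by 0 outside
   [0,1] only influences the values at 0, at 1 and outside [0,1]. *)
Definition cderiv f : R -> Cplx R := fun x =>
  Complex (derive1 (fun t => complex.Re ('valL_ 0 f t)) x)
          (derive1 (fun t => complex.Im ('valL_ 0 f t)) x).

Definition LpnormE p (g : R -> Cplx R) : \bar R :=
  'N[lebesgue01]_p[(fun x : measurableTypeR R => (Normc.normc (g x))%:E)].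

Definition in_Lp p (g : R -> Cplx R) : Prop :=
  [/\ measurable_fun Icc01 (fun x => complex.Re (g x)),
      measurable_fun Icc01 (fun x => complex.Im (g x))
    & (LpnormE p g < +oo)%E].

Definition ACp p : set (Icc01 -> Cplx R) :=
  [set f | [/\ abs_continuous f,
               forall x : Icc01, \val x = 0 -> f x = 0
             & in_Lp p (cderiv f)]].

Definition ACp_norm p f : R := fine (LpnormE p (cderiv f)).

End AbsolutelyContinuous.

Arguments Icc01 R : clear implicits.
Arguments Ioc01 R : clear implicits.

(* Main.v *)
Require Import Defs.
From HB Require Import structures.
From mathcomp Require Import all_boot all_order all_algebra.
From mathcomp Require Import all_classical all_reals all_analysis.
From mathcomp Require Import complex.
From mathcomp Require Import measurable_realfun ess_sup_inf ring lra.
Import Order.TTheory GRing.Theory Num.Theory.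
Import numFieldNormedType.Exports.
Local Open Scope classical_set_scope.
Local Open Scope ring_scope.
Set Implicit Arguments.
Unset Strict Implicit.
Unset Printing Implicit Defensive.

(* Two facts carry everything.

   Fundamental theorem of calculus.  The positive variation of an absolutely
   continuous F is monotone and absolutely continuous, so F is a difference of
   monotone absolutely continuous functions.  The Stieltjes measure of such a
   function vanishes on Lebesgue null sets, and Radon-Nikodym provides a
   density; Lebesgue differentiation identifies it with the derivative.

   Sup bound.  |f(x)| <= 2 |||f|||_p (the factor 2 comes from estimating real and
   imaginary parts separately), and for p = oo even |f(x)| <= 2 x |||f|||_oo.

   Completeness: a subsequence of the derivatives converges almost everywhere,
   Fatou's lemma makes the norm lower semicontinuous, and the limit derivative is
   integrated back.  For p finite the cutoffs e_n(x) = min (n x) 1 form an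
   approximate identity: (e_n f - f)' lives on [0, 1/n], and n |f| is controlled
   there by Hoelder's inequality.  For p = oo, applying the sup bound to
   e x - x gives |e(x) - 1| <= 2 |||e x - x|||_oo, which is impossible near 0 when
   the right hand side is small.

   Characters: given a character phi, put l = phi(x), m = phi(f) and
   h = |x - l|^2 + |f - m|^2.  If h had no zero, then 1/h would belong to the
   algebra with a unit adjoined, contradicting phi(h) = 0; at a zero t of h,
   phi(x) = t and phi(f) = f(t). *)

(** * Absolutely continuous functions on the line *)

(** The definitions concern complex functions on a subtype, the calculus real functions on the line.
    Composition with the retraction [clamp] onto [0, 1] links them: real and imaginary parts become
    constant outside [0, 1] and stay absolutely continuous, whereas the extension by 0 inside
    [cderiv] jumps at 1 unless f(1) = 0. For finite p the slope n of the cutoff is exactly offset: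
    by Hoelder, |f| on [0, 1/n] is at most a constant times n^(1/p - 1) times the L^p norm of f'
    there, while n times the indicator of [0, 1/n] has L^p norm n^(1 - 1/p). Convergence then comes
    only from the integral of |f'|^p over [0, 1/n] tending to 0, which has no analogue for p = oo.
    For characters, nothing is known at first about the relation between phi(f) and phi(conj f). So
    h is expanded as (x - l)(x - conj l) + (f - m)(conj f - conj m): each product has a factor
    killed by phi, whatever phi(conj f) is. The summand in x makes the point t independent of f. *)

Section Families.
Context {R : realType}.
Implicit Types (F G : R -> R) (p q : R * R) (l : seq (R * R)).

(** Symmetric, so that a family need not be sorted and survives filtering. *)
Definition sep p q := (p.2 <= q.1) || (q.2 <= p.1).

Definition nonoverlap l := all (fun p => p.1 <= p.2) l && pairwise sep l.

Definition inside (x y : R) l := all (fun p => (x <= p.1) && (p.2 <= y)) l.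

Definition incr F l := \sum_(p <- l) (F p.2 - F p.1).

Definition absincr F l := \sum_(p <- l) `|F p.2 - F p.1|.

(* Quantifies over finite lists rather than over families indexed by ['I_n],
   so that families can be cut and concatenated. *)
Definition AC F := forall e : R, 0 < e -> exists2 d : R, 0 < d &
  forall l, nonoverlap l -> incr id l < d -> absincr F l < e.

Definition mapf (h : R -> R) l := [seq (h p.1, h p.2) | p <- l].

Lemma nonoverlap_map (h : R -> R) l : {homo h : x y / x <= y} ->
  nonoverlap l -> nonoverlap (mapf h l).
Proof.
move=> hh /andP[la lp]; apply/andP; split.
  by rewrite all_map; apply: sub_all la => p /=; exact: hh.
rewrite pairwise_map; apply: sub_pairwise lp => p q /orP[] /hh; rewrite /= /sep /=.
  by move=> ->.
by move=> ->; rewrite orbT.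
Qed.

Lemma nonoverlap_cons p l : nonoverlap (p :: l) = [&& p.1 <= p.2, all (sep p) l & nonoverlap l].
Proof.
by rewrite /nonoverlap /= -!andbA; congr (_ && _); rewrite andbCA.
Qed.

Lemma nonoverlap_cat l1 l2 : nonoverlap (l1 ++ l2) =
  [&& allrel sep l1 l2, nonoverlap l1 & nonoverlap l2].
Proof.
rewrite /nonoverlap all_cat pairwise_cat.
by case: (all _ l1); case: (all _ l2); case: (allrel _ _ _); case: (pairwise _ l1).
Qed.

Lemma incr_cat F l1 l2 : incr F (l1 ++ l2) = incr F l1 + incr F l2.
Proof. exact: big_cat. Qed.

Lemma incr_cons F p l : incr F (p :: l) = F p.2 - F p.1 + incr F l.
Proof. exact: big_cons. Qed.

Lemma incr_map F h l : incr F (mapf h l) = incr (F \o h) l.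
Proof. exact: big_map. Qed.

Lemma absincr_map F h l : absincr F (mapf h l) = absincr (F \o h) l.
Proof. exact: big_map. Qed.

Lemma incr_le_abs F l : incr F l <= absincr F l.
Proof. by apply: ler_sum => p _; exact: ler_norm. Qed.

Lemma incr_homo F l : {homo F : x y / x <= y} -> nonoverlap l -> incr F l = absincr F l.
Proof.
move=> hF /andP[/allP la _]; apply: eq_big_seq => p /la pl.
by rewrite ger0_norm// subr_ge0 hF.
Qed.

(** As the list is unsorted, the head interval splits the tail into the intervals on its left and
    those on its right. Both sublists are shorter than the list, hence the induction on a bound for
    the size. *)
Lemma incr_inside G x y l : {homo G : x y / x <= y} -> x <= y ->
  nonoverlap l -> inside x y l -> incr G l <= G y - G x.
Proof.
move=> hG; have [n] := ubnP (size l); elim: n l x y => // n IH [|p l] x y.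
  by move=> _ xy _ _; rewrite /incr big_nil subr_ge0 hG.
rewrite /= ltnS => ln xy; rewrite nonoverlap_cons => /and3P[p12 /allP pl fl].
move=> /andP[/andP[xp py] wl].
have -> : incr G (p :: l) = G p.2 - G p.1 + (incr G [seq i <- l | i.2 <= p.1] +
    incr G [seq i <- l | ~~ (i.2 <= p.1)]).
  by rewrite incr_cons /incr !big_filter (bigID (fun q : R * R => q.2 <= p.1)).
have famf (a : pred (R * R)) : nonoverlap [seq q <- l | a q].
  move/andP: fl => [fl1 fl2]; apply/andP; split; last exact: pairwise_filter.
  by apply/allP => q; rewrite mem_filter => /andP[_] /(allP fl1).
have sizef (a : pred (R * R)) : (size [seq q <- l | a q] < n)%N.
  by rewrite size_filter (leq_ltn_trans _ ln) ?count_size.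
have L : incr G [seq i <- l | i.2 <= p.1] <= G p.1 - G x.
  apply: IH => //; apply/allP => q; rewrite mem_filter => /andP[qp /(allP wl)].
  by move=> /andP[-> _].
have M : incr G [seq i <- l | ~~ (i.2 <= p.1)] <= G y - G p.2.
  apply: IH => //; apply/allP => q; rewrite mem_filter => /andP[qp ql].
  have /andP[_ ->] := allP wl _ ql.
  by have := pl _ ql; rewrite /sep (negbTE qp) orbF => ->.
by lra.
Qed.

(** Pointwise [F (min c x) + F (max c x) = F c + F x], so cutting every interval at [c] loses no
    increment. *)
Lemma incr_split F c l : nonoverlap l ->
  incr F l = incr F (mapf (Num.min c) l) + incr F (mapf (Num.max c) l).
Proof.
move=> /andP[/allP lf _]; rewrite !incr_map /incr -big_split /=.
apply: eq_big_seq => p /lf /= p12.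
by case: (leP c p.1); case: (leP c p.2) => /=; lra.
Qed.

Lemma min_homo (c : R) : {homo Num.min c : x y / x <= y}.
Proof. by move=> x y xy; rewrite /Num.min; do 2 case: ifPn; lra. Qed.

Lemma max_homo (c : R) : {homo Num.max c : x y / x <= y}.
Proof. by move=> x y xy; rewrite /Num.max; do 2 case: ifPn; lra. Qed.

(** Retraction of the line onto [0, 1]; it is monotone and 1-Lipschitz, so precomposition with it
    preserves absolute continuity. *)
Definition clamp (t : R) := Num.max 0 (Num.min 1 t).

Lemma clamp_homo : {homo clamp : x y / x <= y}.
Proof. by move=> x y xy; apply/max_homo/min_homo. Qed.

Lemma clamp_lip x y : x <= y -> clamp y - clamp x <= y - x.
Proof.
by rewrite /clamp /Num.max /Num.min => xy; do !case: ifPn; lra.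
Qed.

Lemma clamp_itv t : 0 <= clamp t <= 1.
Proof. by rewrite /clamp /Num.max /Num.min; do !case: ifPn; lra. Qed.

Lemma clamp_id t : 0 <= t <= 1 -> clamp t = t.
Proof. by rewrite /clamp /Num.max /Num.min; do !case: ifPn; lra. Qed.

Lemma clampK t : clamp (clamp t) = clamp t.
Proof. by rewrite clamp_id// clamp_itv. Qed.

Lemma AC_clamp F : AC F -> AC (F \o clamp).
Proof.
move=> FAC e /FAC[d d0 dP]; exists d => // l lf ld.
rewrite -absincr_map; apply: dP; first exact: nonoverlap_map clamp_homo lf.
rewrite incr_map; apply: le_lt_trans ld.
rewrite /incr big_seq [leRHS]big_seq; apply: ler_sum => p.
by case/andP: lf => /allP lf _ /lf /clamp_lip.
Qed.

End Families.

(** * Positive variation of an absolutely continuous function *)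

Section PositiveVariation.
Context {R : realType}.
Variable F : R -> R.
Hypotheses (FAC : AC F) (F01 : forall t, F t = F (clamp t)).

(* An interval of length 1/(n+1) carries variation at most 1; [K k] climbs
   from [0, k/(n+1)] to [0, (k+1)/(n+1)]. *)
Lemma incr_bounded : exists M : R, forall l, nonoverlap l -> incr F l <= M.
Proof.
have [d d0 dP] := FAC ltr01.
have [n nd] : exists n : nat, (n.+1%:R)^-1 < d :> R.
  have := near_infty_natSinv_lt (PosNum d0).
  by case=> N _ /(_ N (leqnn _)) ?; exists N.
have n0 : 0 < n.+1%:R :> R by [].
have K (k : nat) : exists M : R, forall l, nonoverlap l ->
    incr F (mapf (Num.min (k%:R / n.+1%:R)) l) <= M.
  elim: k => [|k [M IH]].
    exists 0 => l lf; rewrite incr_map /incr big1// => p _ /=.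
    have clamp0 t : clamp (Num.min 0 t) = 0 :> R.
      by apply/max_idPl; rewrite !ge_min lexx orbT.
    by rewrite mul0r F01 [X in _ - X]F01 !clamp0 subrr.
  exists (M + 1) => l lf; set l' := mapf _ l.
  have lf' : nonoverlap l' by apply: nonoverlap_map => //; exact: min_homo.
  rewrite (incr_split F (k%:R / n.+1%:R) lf') lerD ?IH//.
  apply: le_trans (incr_le_abs _ _) _; apply/ltW/dP.
    by apply: nonoverlap_map => //; exact: max_homo.
  apply: le_lt_trans nd.
  have knn : k%:R / n.+1%:R + n.+1%:R^-1 = k.+1%:R / n.+1%:R :> R.
    by rewrite -(@natr1 _ k) mulrDl mul1r.
  have nn0 : 0 < n.+1%:R^-1 :> R by rewrite invr_gt0.
  rewrite [leRHS](_ : _ = k.+1%:R / n.+1%:R - k%:R / n.+1%:R); last first.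
    by rewrite -knn addrAC subrr add0r.
  apply: (@incr_inside R id).
  - by move=> ? ?.
  - by rewrite -knn lerDl ltW.
  - by apply: nonoverlap_map => //; exact: max_homo.
  - rewrite /inside all_map all_map; apply/allP => p _ /=.
    rewrite le_max lexx /= ge_max -{1}knn lerDl ltW//=.
    by rewrite ge_min lexx.
(* At [k = n + 1] the cut is at 1, and [F] does not see it since [F] factors through [clamp]. *)
have [M MP] := K n.+1; exists M => l /MP.
rewrite incr_map /incr; congr (_ <= _); apply: eq_bigr => p _ /=.
rewrite divff// !(F01 (Num.min _ _)) [in RHS](F01 p.1) [in RHS](F01 p.2).
by rewrite /clamp !minA !minxx.
Qed.

(** The increments are signed: leaving out the intervals on which [F] decreases makes the supremum
    the positive variation of [F] up to [x]. *)
Definition posvar (x : R) := sup [set incr F l | l in [set l |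
  nonoverlap l /\ all (fun p => p.2 <= x) l]].

Lemma posvar_has_sup x : has_sup [set incr F l | l in [set l |
  nonoverlap l /\ all (fun p => p.2 <= x) l]].
Proof.
have [M MP] := incr_bounded.
split; first by exists (incr F [::]), [::].
by exists M => _ [l [lf _] <-]; exact: MP.
Qed.

Lemma posvar_ub x l : nonoverlap l -> all (fun p => p.2 <= x) l -> incr F l <= posvar x.
Proof.
by move=> lf lx; apply: (sup_upper_bound (posvar_has_sup x)); exists l.
Qed.

(** A family ending before [x] may be enlarged by the interval from [x] to [y]. This is what makes
    [posvar - F] monotone. *)
Lemma posvar_incr x y : x <= y -> F y - F x <= posvar y - posvar x.
Proof.
move=> xy; rewrite lerBrDr addrC -lerBrDr.
apply: ge_sup; first by exists (incr F [::]), [::].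
move=> _ [l [lf lx] <-]; rewrite lerBrDr addrC.
have -> : F y - F x + incr F l = incr F ((x, y) :: l) by rewrite incr_cons.
apply: posvar_ub; last first.
  by rewrite /= lexx /=; apply: sub_all lx => p /le_trans; exact.
rewrite nonoverlap_cons /= xy lf andbT; apply: sub_all lx => p px.
by rewrite /sep px orbT.
Qed.

Lemma posvar_homo : {homo posvar : x y / x <= y}.
Proof.
move=> x y xy; apply: ge_sup; first by exists (incr F [::]), [::].
move=> _ [l [lf lx] <-]; apply: posvar_ub => //.
by apply: sub_all lx => p /le_trans; exact.
Qed.

(** A nearly optimal family for [y] is cut at [x]; its left part accounts for at most [posvar x], so
    the right part must carry the rest. *)
Lemma posvar_approx x y e : x <= y -> 0 < e -> exists l,
  [/\ nonoverlap l, inside x y l & posvar y - posvar x - e <= incr F l].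
Proof.
move=> xy e0; have [_ [l [lf ly] <-] le] := sup_adherent e0 (posvar_has_sup y).
exists (mapf (Num.max x) l); split.
- by apply: nonoverlap_map => //; exact: max_homo.
- rewrite /inside all_map; apply: sub_all ly => p /= py.
  by rewrite le_max lexx /= ge_max xy.
- rewrite -/(posvar y) (incr_split F x lf) in le.
  have : incr F (mapf (Num.min x) l) <= posvar x.
    apply: posvar_ub; first by apply: nonoverlap_map => //; exact: min_homo.
    by rewrite all_map; apply/allP => p _ /=; rewrite ge_min lexx.
  by lra.
Qed.

(** Each interval of [L] is replaced by a nearly optimal family inside it, the error being halved at
    every step. The total length does not grow, so a modulus of absolute continuity for [F] also
    serves [posvar]. The containment clause keeps the pieces separated during the induction. *)
Lemma posvar_refine L e : nonoverlap L -> 0 < e -> exists M,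
  [/\ nonoverlap M,
      forall m, m \in M -> exists2 p, p \in L & (p.1 <= m.1) && (m.2 <= p.2),
      incr id M <= incr id L & incr posvar L - e <= incr F M].
Proof.
elim: L e => [|p L IH] e.
  by move=> _ e0; exists [::]; split => //; rewrite /incr !big_nil; lra.
rewrite nonoverlap_cons => /and3P[p12 /allP pL fL] e0.
have [M [fM ML lM iM]] := IH (e / 2) fL ltac:(lra).
have [l [fl wl il]] := @posvar_approx p.1 p.2 (e / 2) p12 ltac:(lra).
exists (l ++ M); split.
- rewrite nonoverlap_cat fl fM !andbT; apply/allrelP => q m /(allP wl) /andP[q1 q2].
  move=> /ML[r /pL]; rewrite /sep => /orP[pr|pr] /andP[rm1 rm2].
    by rewrite (le_trans q2 (le_trans pr _)).
  by rewrite (le_trans _ (le_trans pr q1)) ?orbT.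
- move=> m; rewrite mem_cat => /orP[/(allP wl)|/ML[q qL qm]].
    by exists p; rewrite ?mem_head.
  by exists q; rewrite // inE qL orbT.
- rewrite incr_cat incr_cons lerD//.
  exact: (@incr_inside _ id p.1 p.2).
- by rewrite incr_cat incr_cons; lra.
Qed.

Lemma posvar_AC : AC posvar.
Proof.
move=> e e0; have e20 : 0 < e / 2 by lra.
have [d d0 dP] := FAC e20; exists d => // L fL Ld.
have [M [fM _ lM iM]] := posvar_refine fL e20.
rewrite -incr_homo//; last exact: posvar_homo.
have := dP _ fM (le_lt_trans lM Ld); have := incr_le_abs F M; lra.
Qed.

End PositiveVariation.

(** * Closure properties of absolute continuity *)

Section ACclosure.
Context {R : realType}.
Implicit Types F G H : R -> R.

(** Sums, multiples, products and inverses all reduce to this comparison of increments. *)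
Lemma AC_dom F G H (K : R) : AC F -> AC G ->
  (forall x y, `|H y - H x| <= K * (`|F y - F x| + `|G y - G x|)) -> AC H.
Proof.
move=> aF aG HFG e e0.
have K0 : 0 < `|K| + 1 by rewrite ltr_pwDr.
have e1 : 0 < e / (2 * (`|K| + 1)) by rewrite divr_gt0// mulr_gt0.
have [d1 d10 d1P] := aF _ e1; have [d2 d20 d2P] := aG _ e1.
exists (Num.min d1 d2); first by rewrite lt_min d10.
move=> l fl; rewrite lt_min => /andP[/(d1P _ fl) + /(d2P _ fl)].
rewrite !ltr_pdivlMr ?mulr_gt0// => l1 l2.
have : absincr H l <= (`|K| + 1) * (absincr F l + absincr G l).
  rewrite /absincr -big_split mulr_sumr; apply: ler_sum => p _ /=.
  apply: le_trans (HFG _ _) _; rewrite ler_wpM2r ?addr_ge0//.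
  by rewrite (le_trans (ler_norm K))// lerDl.
by move=> /le_lt_trans; apply; lra.
Qed.

Lemma ACD F G : AC F -> AC G -> AC (fun t => F t + G t).
Proof.
move=> aF aG; apply: (AC_dom (K := 1) aF aG) => x y; rewrite mul1r.
rewrite (le_trans _ (ler_normD _ _))// le_eqVlt; apply/orP; left; apply/eqP.
by congr (`| _ |); ring.
Qed.

Lemma ACZ c F : AC F -> AC (fun t => c * F t).
Proof.
move=> aF; apply: (AC_dom (K := `|c|) aF aF) => x y.
by rewrite -mulrBr normrM ler_wpM2l// lerDl.
Qed.

Lemma ACB F G : AC F -> AC G -> AC (fun t => F t - G t).
Proof.
move=> aF aG; apply: (AC_dom (K := 1) aF aG) => x y; rewrite mul1r.
rewrite (le_trans _ (ler_normB _ _))// le_eqVlt; apply/orP; left; apply/eqP.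
by congr (`| _ |); ring.
Qed.

Lemma ACM F G (M : R) : (forall t, `|F t| <= M) -> (forall t, `|G t| <= M) ->
  AC F -> AC G -> AC (fun t => F t * G t).
Proof.
move=> FM GM aF aG; apply: (AC_dom (K := M) aF aG) => x y.
have -> : F y * G y - F x * G x = F y * (G y - G x) + G x * (F y - F x) by ring.
rewrite (le_trans (ler_normD _ _))// !normrM addrC mulrDr.
by rewrite lerD// ler_wpM2r.
Qed.

Lemma ACV F (m : R) : 0 < m -> (forall t, m <= F t) -> AC F -> AC (fun t => (F t)^-1).
Proof.
move=> m0 mF aF; apply: (AC_dom (K := (m ^+ 2)^-1) aF aF) => x y.
have F0 t : 0 < F t by rewrite (lt_le_trans m0).
have -> : (F y)^-1 - (F x)^-1 = (F x * F y)^-1 * - (F y - F x).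
  by field; rewrite !gt_eqF.
rewrite normrM normrN ler_pM// ?lerDl// normfV ler_pV2 ?inE ?unitfE.
- by rewrite normrM !gtr0_norm// expr2 ler_pM// ltW.
- by rewrite gt_eqF normr_gt0 mulf_neq0// gt_eqF.
- by rewrite gt_eqF exprn_gt0// exprn_gt0.
Qed.

Lemma AC_lip F (K : R) : (forall x y, `|F y - F x| <= K * `|y - x|) -> AC F.
Proof.
move=> FK e e0.
have K0 : 0 < `|K| + 1 by rewrite ltr_pwDr.
exists (e / (`|K| + 1)); first by rewrite divr_gt0.
move=> l fl; rewrite ltr_pdivlMr// mulrC => le; apply: le_lt_trans le.
rewrite (incr_homo (F := id))// /absincr mulr_sumr; apply: ler_sum => p _.
apply: le_trans (FK _ _) _; rewrite ler_wpM2r//.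
by rewrite (le_trans (ler_norm K))// lerDl.
Qed.

Lemma AC_pair F e : AC F -> 0 < e ->
  exists2 d : R, 0 < d & forall x y, `|y - x| < d -> `|F y - F x| < e.
Proof.
move=> aF e0; have [d d0 dP] := aF _ e0; exists d => // x y.
wlog xy : x y / x <= y => [H|].
  have [/H//|/ltW yx] := leP x y.
  by rewrite distrC => /(H _ _ yx); rewrite distrC.
have := dP [:: (x, y)]; rewrite /nonoverlap /incr /absincr /= !big_seq1/= xy.
by move=> + h; apply => //; apply: le_lt_trans h; exact: ler_norm.
Qed.

Lemma AC_continuous F : AC F -> continuous F.
Proof.
move=> aF x; apply/cvgrPdist_lt => e e0; have [d d0 dP] := AC_pair aF e0.
near=> t; apply: dP; near: t; exact: cvgr_dist_lt.
Unshelve. all: by end_near. Qed.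

Lemma AC_monotone_decomposition F : AC F -> (forall t, F t = F (clamp t)) ->
  exists G H, [/\ AC G /\ AC H,
    {homo G : x y / x <= y} /\ {homo H : x y / x <= y},
    forall t, G t = G (clamp t), forall t, H t = H (clamp t) &
    forall t, F t = G t - H t].
Proof.
move=> aF F01; pose P := posvar F; pose Q t := P t - F t.
have aP : AC P by exact: posvar_AC.
have aQ : AC Q by exact: ACB.
(* Clamping makes both monotone parts constant outside [0, 1]; their difference is unchanged because
   [F] already factors through [clamp]. *)
exists (P \o clamp), (Q \o clamp); split.
- by split; exact: AC_clamp.
- split=> x y /clamp_homo; first exact: posvar_homo.
  by move=> /(posvar_incr aF F01); rewrite /Q -/P /=; lra.
- by move=> t /=; rewrite clampK.
- by move=> t /=; rewrite clampK.
- by move=> t; rewrite /= /Q -F01; lra.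
Qed.

End ACclosure.

(** * The fundamental theorem of calculus *)

Section MonotoneAC.
Context {R : realType}.

(** The covers provided by outer measure may overlap, while [AC] tests non-overlapping families.
    When an interval from [a] to [b] is added, the earlier family is clipped to the left of [a] and
    to the right of [b], which cannot increase its length. *)
Lemma nonoverlap_cover (B : seq (R * R)) : all (fun p => p.1 <= p.2) B ->
  exists M, [/\ nonoverlap M, incr id M <= incr id B &
    forall t, has (fun p => p.1 < t <= p.2) B -> has (fun p => p.1 < t <= p.2) M].
Proof.
elim: B => [_|[a b] B IH /= /andP[ab /IH[M [fM lM BM]]]]; first by exists [::].
exists ((a, b) :: mapf (Num.min a) M ++ mapf (Num.max b) M).
have fm (c : R) := nonoverlap_map (@min_homo R c) fM.
have fM' (c : R) := nonoverlap_map (@max_homo R c) fM.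
split.
- rewrite nonoverlap_cons ab nonoverlap_cat fm fM' /= !andbT; apply/andP; split.
    rewrite all_cat !all_map; apply/andP; split; apply/allP => p _ /=.
      by rewrite /sep /= !ge_min lexx orbT.
    by rewrite /sep /= !le_max lexx.
  apply/allrelP => _ _ /mapP[p _ ->] /mapP[q _ ->].
  by rewrite /sep /= (@le_trans _ _ a) ?ge_min ?le_max ?lexx ?ab.
- rewrite !incr_cons incr_cat lerD2l (le_trans _ lM)// !incr_map.
  rewrite /incr -big_split /= big_seq [leRHS]big_seq; apply: ler_sum => p.
  case/andP: fM => /allP fM _ /fM; rewrite /Num.max /Num.min => /= pp.
  by do !case: ifPn; lra.
- move=> t /=; have [//|tab/= /BM] := boolP (a < t <= b).
  move=> /hasP[p pM /andP[pt tp]]; apply/hasP.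
  have [ta|at_] := leP t a.
    exists (Num.min a p.1, Num.min a p.2).
      by rewrite mem_cat; apply/orP; left; apply/mapP; exists p.
    by rewrite /= gt_min le_min pt ta tp orbT.
  have bt : b < t by move: tab; rewrite at_ /= -ltNge.
  exists (Num.max b p.1, Num.max b p.2).
    by rewrite mem_cat; apply/orP; right; apply/mapP; exists p.
  by rewrite /= gt_max le_max bt pt tp orbT.
Qed.

Variable G : cumulative R R.
Hypothesis aG : AC G.

Let nu : {measure set (measurableTypeR R) -> \bar R} :=
  lebesgue_stieltjes_measure G.

Lemma stieltjes_itvoc a b : a <= b -> nu `]a, b]%classic = (G b - G a)%:E.
Proof.
move=> ab; transitivity (wlength G `]a, b]%classic).
  by apply: measurable_mu_extE; exact: is_ocitv.
by rewrite wlength_itv_bnd.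
Qed.

Lemma stieltjes_bigsetU (M : seq (R * R)) : nonoverlap M ->
  (nu (\big[setU/set0]_(m <- M) `]m.1, m.2]%classic) <= (incr G M)%:E)%E.
Proof.
elim: M => [_|m M IH]; first by rewrite big_nil measure0 /incr big_nil.
rewrite nonoverlap_cons => /and3P[m12 _ /IH {}IH].
rewrite big_cons incr_cons EFinD.
apply: le_trans (measureU2 _ _ _) _ => //.
  by apply: bigsetU_measurable => i _; exact: measurable_itv.
by apply: leeD => //; rewrite le_eqVlt; apply/orP; left; apply/eqP; exact: stieltjes_itvoc.
Qed.

(** Lebesgue measure is an infimum over covers by half-open intervals, so [A] has a cover of total
    length below [d]. As [AC] speaks of finite families, the bound [e] is proved for finite unions
    of the cover and passed to the whole by continuity from below. *)
Lemma stieltjes_null (A : set (measurableTypeR R)) : measurable A ->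
  lebesgue_measure A = 0%E -> nu A = 0%E.
Proof.
move=> mA A0; apply/eqP; rewrite eq_le measure_ge0 andbT.
apply/lee_addgt0Pr => e e0; rewrite add0e.
have [d d0 dP] := aG e0.
have [_ [B [mB AB] <-] Bd] : exists2 x, [set (\sum_(0 <= k <oo)
    wlength idfun (A0 k))%E | A0 in @measurable_cover _ (ocitv_type R) A] x &
    (x < d%:E)%E.
  apply: ereal_inf_lt; apply: (@le_lt_trans _ _ (lebesgue_measure A)).
    by [].
  by rewrite A0 lte_fin.
have /choice[p pP] : forall k, exists q : R * R, q.1 <= q.2 /\
    B k = `]q.1, q.2]%classic.
  move=> k.
  have /ocitvP[->|[q q12 ->]] := mB k.
    by exists (0, 0); split => //=; rewrite set_itvoc0.
  by exists q; split => //; exact: ltW.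
have mB' k : @measurable _ (measurableTypeR R) (B k).
  by have [_ ->] := pP k; exact: measurable_itv.
have fin n : (nu (\big[setU/set0]_(k < n) B k) <= e%:E)%E.
  have [] := @nonoverlap_cover (mkseq p n).
    by apply/allP => _ /mapP[k _ ->]; have [] := pP k.
  move=> M [fM lM BM].
  apply: (@le_trans _ _ (nu (\big[setU/set0]_(m <- M) `]m.1, m.2]%classic))).
    apply: le_measure; rewrite ?inE.
    - by apply: bigsetU_measurable.
    - by apply: bigsetU_measurable => i _; exact: measurable_itv.
    move=> t; rewrite -bigcup_mkord -bigcup_seq => -[k /= kn].
    have [_ ->] := pP k; rewrite /= in_itv /= => tk.
    have /hasP[m mM tm] : has (fun p => p.1 < t <= p.2) M.
      apply: BM; apply/hasP; exists (p k) => //.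
      by apply/mapP; exists k => //; rewrite mem_iota.
    by exists m => //=; rewrite in_itv.
  apply: le_trans (stieltjes_bigsetU fM) _; rewrite lee_fin.
  apply/ltW/(le_lt_trans (incr_le_abs G M))/dP => //.
  apply: le_lt_trans lM _; rewrite -lte_fin; apply: le_lt_trans Bd.
  have -> : ((incr id (mkseq p n))%:E = \sum_(0 <= k < n) wlength idfun (B k))%E.
    rewrite /incr /mkseq big_map -sumEFin /index_iota subn0.
    apply: eq_bigr => k _; have [pk ->] := pP k.
    by rewrite wlength_itv_bnd.
  apply: nneseries_lim_ge => k _ _; have [pk ->] := pP k.
  by rewrite wlength_itv_bnd// lee_fin subr_ge0.
apply: (@le_trans _ _ (nu (\bigcup_k B k))).
  by apply: le_measure => //; rewrite inE//; exact: bigcupT_measurable.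
rewrite -bigcup_bigsetU_bigcup.
have mBn n : @measurable _ (measurableTypeR R) (\big[setU/set0]_(k < n) B k).
  exact: bigsetU_measurable.
have cv : nu \o (fun n => \big[setU/set0]_(k < n.+1) B k) @ \oo -->
    nu (\bigcup_n \big[setU/set0]_(k < n.+1) B k).
  apply: nondecreasing_cvg_mu; first by move=> n; exact: mBn.
    by apply: bigcupT_measurable => n; exact: mBn.
  by move=> m n mn; apply/subsetPset/subset_bigsetU.
rewrite -(cvg_lim _ cv) //; apply: lime_le; last by apply: nearW => n; exact: fin.
by apply/cvg_ex; eexists; exact: cv.
Qed.

End MonotoneAC.

(** * Densities and primitives *)

Section Density.
Context {R : realType}.
Local Notation leb := (@lebesgue_measure R).
Implicit Types F G g : R -> R.

Lemma AC_monotone_density G : AC G -> {homo G : x y / x <= y} ->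
  (forall t, G t = G (clamp t)) ->
  exists2 g : R -> R, leb.-integrable setT (EFin \o g) &
    forall x, G x = G 0 + \int[leb]_(t in `]-oo, x]) g t.
Proof.
move=> aG hG G01.
have rc : right_continuous G by apply: right_continuousW => x; exact: AC_continuous.
pose G' : cumulative R R := HB.pack G (isCumulative.Build R _ R G hG rc).
pose nu : {measure set (measurableTypeR R) -> \bar R} :=
  lebesgue_stieltjes_measure G'.
have mD : measurable (`]0, 1]%classic : set (measurableTypeR R)).
  exact: measurable_itv.
have itv a b : a <= b -> nu `]a, b]%classic = (G b - G a)%:E.
  exact: (@stieltjes_itvoc R G').
have Doo : (nu `]0%R, 1%R]%classic < +oo)%E by rewrite itv// ltry.
(* The restriction to []0, 1]] is a finite measure, so its density is integrable; [G] is constant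
   elsewhere and no mass is lost. *)
pose nu1 := mfrestr mD Doo.
have nu1_dom : nu1 `<< leb.
  apply/null_content_dominatesP => A mA A0.
  rewrite /nu1 /mfrestr /mrestr; apply: (@stieltjes_null R G') => //.
    exact: measurableI.
  by apply: subset_measure0 A0 => //; exact: measurableI.
have [f [f0 ffin fint fE]] := radon_nikodym_sigma_finite nu1_dom.
have efine : EFin \o (fine \o f) = f by apply/funext => t /=; rewrite fineK.
exists (fine \o f); first by rewrite efine.
move=> x.
have Ix : `]-oo, x]%classic `&` `]0, 1]%classic = `]0, clamp x]%classic :> set R.
  apply/seteqP; split => t /=; rewrite !in_itv/= /clamp.
    by move=> [tx /andP[-> t1]]; rewrite le_max le_min tx t1 orbT.
  move=> /andP[t0]; rewrite le_max leNgt t0 /= le_min => /andP[t1 tx].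
  by rewrite t1.
rewrite /Rintegral -/(EFin \o (fine \o f)).
under eq_integral do rewrite /= fineK//.
rewrite -fE; last exact: (@measurable_itv R).
rewrite [X in fine X](_ : _ = nu `]0, clamp x]%classic); last by rewrite -Ix.
rewrite itv; last by case/andP: (clamp_itv x).
by rewrite /= addrC subrK -G01.
Qed.

Lemma AC_density F : AC F -> (forall t, F t = F (clamp t)) ->
  exists2 g : R -> R, leb.-integrable setT (EFin \o g) &
    forall x, F x = F 0 + \int[leb]_(t in `]-oo, x]) g t.
Proof.
move=> aF F01.
have [G [H [[aG aH] [hG hH] G01 H01 FE]]] := AC_monotone_decomposition aF F01.
have [g ig gE] := AC_monotone_density aG hG G01.
have [h ih hE] := AC_monotone_density aH hH H01.
exists (fun t => g t - h t).
  rewrite [X in integrable _ _ X](_ : _ = (EFin \o g) \- (EFin \o h))%E; last first.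
    by apply/funext.
  exact: integrableB.
move=> x; rewrite !FE gE hE RintegralB//; first ring.
- by apply: integrableS ig => //.
- by apply: integrableS ih => //.
Qed.

Definition primitive g x : R := \int[leb]_(t in `]-oo, x]) g t.

Lemma primitiveB g x y : leb.-integrable setT (EFin \o g) -> x <= y ->
  primitive g y - primitive g x = \int[leb]_(t in `]x, y]) g t.
Proof.
move=> ig xy; apply: Rintegral_itvB => //.
exact: integrableS ig.
Qed.

Lemma primitive_AC g : leb.-integrable setT (EFin \o g) -> AC (primitive g).
Proof.
move=> ig e e0.
have [d [d0 dP]] := integral_normr_continuous ig e0.
exists d => // l nl ld.
pose U (m : seq (R * R)) := \big[setU/set0]_(p <- m) `]p.1, p.2]%classic.
have mU m : measurable (U m : set (measurableTypeR R)).
  by apply: bigsetU_measurable => p _; exact: measurable_itv.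
have iabs A : measurable A -> leb.-integrable A (EFin \o (fun t => `|g t|)).
  move=> mA; apply: (@integrableS _ _ _ _ setT) => //.
  exact: (integrable_abse ig).
apply: (@le_lt_trans _ _ (\int[leb]_(t in U l) `|g t|)); last first.
  (* Lebesgue measure is the Stieltjes measure of the identity, so the union has measure at most the
     total length of the family. *)
  apply: dP => //; apply: le_lt_trans (@stieltjes_bigsetU R idfun l nl) _.
  by rewrite lte_fin.
elim: l nl {ld} => [_|p l IH].
  by rewrite /absincr /U !big_nil Rintegral_set0.
rewrite nonoverlap_cons => /and3P[p12 /allP pl /IH {}IH].
rewrite /absincr /U !big_cons -/(U l) Rintegral_setU//; last 2 first.
- by apply: iabs; apply: measurableU => //; exact: (@measurable_itv R).
- apply/disj_setPS => t [] /=; rewrite in_itv/= => /andP[pt tp].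
  rewrite /U -bigcup_seq => -[q /= /pl /orP[]]; rewrite in_itv/= => pq /andP[qt tq].
    by have := le_lt_trans (le_trans tp pq) qt; rewrite ltxx.
  by have := lt_le_trans pt (le_trans tq pq); rewrite ltxx.
rewrite lerD// primitiveB//; apply: le_normr_Rintegral; first exact: (@measurable_itv R).
exact: integrableS ig.
Qed.

Lemma primitive_derive g : leb.-integrable setT (EFin \o g) ->
  {ae leb, forall x, derivable (primitive g) x 1 /\ derive1 (primitive g) x = g x}.
Proof.
move=> ig; apply: FTC1Ny => [y|]; first exact: integrableS ig.
by apply: open_integrable_locally => //; exact: openT.
Qed.

End Density.

(** * Measurability of the derivative of a continuous function *)

Section DerivativeMeasurable.
Context {R : realType}.
Implicit Types F G : R -> R.

(* The set [D] where the difference quotients satisfy the Cauchy criterion is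
   an intersection of F_sigma sets; off [D] the derivative is the junk value
   [point] of [lim]. *)
Lemma derive1_measurable F : continuous F -> measurable_fun setT (derive1 F).
Proof.
move=> cF; pose q (h x : R) : R := h^-1 *: (F (h + x) - F x).
have cq h : continuous (q h).
  move=> x; apply: cvgZr; apply: cvgB; last exact: cF.
  apply: (@cvg_comp _ _ _ (fun x => h + x) F _ (nbhs (h + x))); last exact: cF.
  by apply: cvgD; [exact: cvg_cst|exact: cvg_id].
pose A (k m : nat) := \bigcap_(hh in [set hh : R * R |
  [/\ hh.1 != 0, hh.2 != 0, `|hh.1| < m.+1%:R^-1 & `|hh.2| < m.+1%:R^-1]])
  [set x | `|q hh.1 x - q hh.2 x| <= k.+1%:R^-1].
have mA k m : measurable (A k m).
  apply: closed_measurable; apply: closed_bigI => hh _.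
  have /continuous_closedP : continuous (fun x => `|q hh.1 x - q hh.2 x|).
    move=> x; apply: cvg_norm; apply: cvgB; exact: cq.
  exact: (fun H => H [set y | y <= k.+1%:R^-1] (@closed_le _ _)).
pose D := \bigcap_k \bigcup_m A k m.
have mD : measurable D.
  by apply: bigcapT_measurable => k; apply: bigcupT_measurable.
have nz (e : R) : 0 < e -> exists2 k : nat, True & k.+1%:R^-1 < e.
  by move=> e0; have [N _ /(_ N (leqnn _)) ?] := near_infty_natSinv_lt (PosNum e0); exists N.
have DP x : D x <-> cvg (q ^~ x @ 0^').
  split => [Dx|/cvg_ex[l /cvgrPdist_lt ql] k _].
    apply/cauchy_cvgP/cauchy_exP => e /nz[k _ ke].
    have [m _ Am] := Dx k I; exists (q m.+2%:R^-1 x).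
    have m0 : 0 < m.+1%:R^-1 :> R by rewrite invr_gt0.
    exists m.+1%:R^-1 => //= h /=; rewrite sub0r normrN => hm h0.
    apply: le_lt_trans ke; apply: (Am (m.+2%:R^-1, h)); split => //=.
    by rewrite gtr0_norm ?invr_gt0// ltf_pV2 ?posrE// ltr_nat.
  have /ql[d /= d0 dP] : 0 < k.+1%:R^-1 / 2 :> R by rewrite divr_gt0// invr_gt0.
  have [m _ md] := nz _ d0; exists m => // -[h h'] /= [h0 h'0 hm h'm].
  have H t : t != 0 -> `|t| < m.+1%:R^-1 -> `|l - q t x| < k.+1%:R^-1 / 2.
    by move=> t0 tm; apply: dP => //=; rewrite sub0r normrN (lt_trans tm).
  have := H _ h0 hm; have := H _ h'0 h'm => H1 H2.
  have -> : q h x - q h' x = (l - q h' x) - (l - q h x) by lra.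
  by apply/(le_trans (ler_normB _ _))/ltW; rewrite [ltRHS]splitr ltrD.
have -> : [set: R] = D `|` ~` D by rewrite setUv.
apply/measurable_funU => //; first exact: measurableC.
split.
  apply: (@measurable_fun_cvg _ _ _ _ (fun n => q n.+1%:R^-1)) => [m|x Dx].
    by apply: measurable_funTS; exact: continuous_measurable_fun.
  have /cvgrPdist_lt cqx : q ^~ x @ 0^' --> derive1 F x by apply/DP.
  apply/cvgrPdist_lt => e /cqx[d /= d0 dP].
  near=> n; apply: dP => /=; last by rewrite invr_eq0 pnatr_eq0.
  rewrite sub0r normrN gtr0_norm ?invr_gt0//.
  by near: n; exact: (near_infty_natSinv_lt (PosNum d0)).
apply: (eq_measurable_fun (cst point)) => [x|]; last exact: measurable_cst.
rewrite inE => Dx; rewrite /derive1 dvgP//.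
by move=> /DP.
Unshelve. all: by end_near. Qed.

End DerivativeMeasurable.

(** * Lp seminorms *)

Section Lnorm_facts.
Local Open Scope ereal_scope.
Context d (T : measurableType d) (R : realType).
Variable mu : {measure set T -> \bar R}.
Implicit Types (f g : T -> R) (p : \bar R).

Let mpow f (r : R) : measurable_fun setT f ->
  measurable_fun setT (fun x => `|(f x)%:E| `^ r).
Proof.
move=> mf; apply/(measurableT_comp (measurable_poweR _))/measurableT_comp => //.
exact/measurable_EFinP.
Qed.

Lemma le_ae_Lnorm p f g : 1 <= p -> measurable_fun setT f -> measurable_fun setT g ->
  {ae mu, forall x, (`|f x| <= `|g x|)%R} ->
  'N[mu]_p[EFin \o f] <= 'N[mu]_p[EFin \o g].
Proof.
move=> p1 mf mg fg; rewrite unlock /Lnorm; case: p p1 => [r| |//]; last first.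
  move=> _; case: ifPn => // _; apply: le_ess_sup.
  by apply: filterS fg => x /=; rewrite lee_fin.
rewrite lee_fin => r1; have r0 : (0 < r)%R by exact: lt_le_trans r1.
have I0 h : 0 <= \int[mu]_x `|(EFin \o h) x| `^ r.
  by apply: integral_ge0 => x _; exact: poweR_ge0.
apply: gt0_ler_poweR.
- by rewrite invr_ge0 ltW.
- by rewrite in_itv/= I0 leey.
- by rewrite in_itv/= I0 leey.
apply: ae_ge0_le_integral => //.
- by move=> x _; exact: poweR_ge0.
- exact: mpow.
- by move=> x _; exact: poweR_ge0.
- exact: mpow.
apply: filterS fg => x /= fgx _; rewrite lee_fin.
by rewrite ge0_ler_powR ?nnegrE// ltW.
Qed.

Lemma Lnorm_scale p f (c : R) : 1 <= p -> measurable_fun setT f ->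
  'N[mu]_p[EFin \o (fun x => c * f x)%R] = `|c|%:E * 'N[mu]_p[EFin \o f].
Proof.
move=> p1 mf; rewrite unlock /Lnorm; case: p p1 => [r| |//]; last first.
  move=> _; case: ifPn => m0; last by rewrite mule0.
  rewrite (_ : abse \o _ = (fun x => `|c|%:E * (abse \o (EFin \o f)) x)); last first.
    by apply/funext => x /=; rewrite normrM EFinM.
  by rewrite ess_supZl.
rewrite lee_fin => r1; have r0 : (0 < r)%R by exact: lt_le_trans r1.
under eq_integral do rewrite /= normrM powRM// EFinM.
rewrite ge0_integralZl ?lee_fin ?powR_ge0//; last exact: (mpow r mf).
rewrite poweRM ?integral_ge0 ?lee_fin ?powR_ge0//.
by rewrite -poweR_EFin -poweRrM mulfV ?gt_eqF// poweRe1.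
Qed.

(** For finite exponents above 1 this is Hoelder against the constant 1, whose norm is 1 because the
    total mass is 1; for p = oo the constant [ess_sup] is integrated. *)
Lemma Lnorm1_le p f : mu setT = 1 -> 1 <= p -> measurable_fun setT f ->
  'N[mu]_1[EFin \o f] <= 'N[mu]_p[EFin \o f].
Proof.
move=> mu1 p1 mf; case: p p1 => [r| |//]; last first.
  move=> _; rewrite Lnorm1 unlock /Lnorm mu1 lte01.
  apply: (@le_trans _ _ (\int[mu]_x cst (ess_sup mu (abse \o (EFin \o f))) x)).
    apply: ae_ge0_le_integral => //.
    - by apply: measurableT_comp => //; exact/measurable_EFinP.
    - move=> x _; apply: ess_sup_gee; first by rewrite mu1 lte01.
      by apply: nearW => y /=.
    - by apply: filterS (ess_sup_ge mu (abse \o (EFin \o f))) => x + _.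
  rewrite integral_cst// [X in _ * X]mu1 mule1//.
rewrite lee_fin le_eqVlt => /predU1P[<-//|r1].
have r0 : (0 < r)%R by exact: lt_trans r1.
have := @hoelder _ _ _ mu f (cst 1%R) r (1 - r^-1)^-1.
rewrite invrK subrKC => /(_ mf (measurable_cst _) r0 _ erefl).
rewrite Lnorm_cst1 mu1 poweR1r mule1 => H.
rewrite [leLHS](_ : _ = 'N[mu]_1[EFin \o (f \* cst 1)%R]); last first.
  by congr Lnorm; apply/funext => x /=; rewrite mulr1.
by apply: H; rewrite invr_gt0 subr_gt0 invf_lt1.
Qed.

Lemma Lnorm_lty_le p r f : mu setT = 1 -> 1 <= p -> p <= r ->
  measurable_fun setT f -> 'N[mu]_r[EFin \o f] < +oo -> 'N[mu]_p[EFin \o f] < +oo.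
Proof.
move=> mu1 p1 pr mf fr.
have fm : f \in Lfun mu r by rewrite inE; apply/andP; split; rewrite inE.
have := Lfun_subset p1 (le_trans p1 pr) _ pr fm; rewrite mu1 => /(_ isT).
by rewrite inE => /andP[_]; rewrite inE.
Qed.

(** For p = oo the countably many exceptional sets are merged and the bound passes to the pointwise
    limit; for finite p Fatou is applied to the r-th powers. *)
Lemma Lnorm_lsc p (v_ : (T -> R)^nat) (v : T -> R) (c : \bar R) : 1 <= p ->
  (forall n, measurable_fun setT (v_ n)) -> measurable_fun setT v ->
  {ae mu, forall x, v_ n x @[n --> \oo] --> (v x : R)} ->
  (forall n, 'N[mu]_p[EFin \o v_ n] <= c) -> 'N[mu]_p[EFin \o v] <= c.
Proof.
move=> p1 mv_ mv cv vc; have c0 : 0 <= c by exact: le_trans (Lnorm_ge0 _ _ _) (vc 0%N).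
have cabs x : v_ n x @[n --> \oo] --> (v x : R) -> `|(v_ n x)%:E| @[n --> \oo] --> `|(v x)%:E|.
  by move=> h; apply: cvg_abse; apply: cvg_EFin => //; exact: nearW.
move: vc; rewrite unlock /Lnorm; case: p p1 => [r| |//]; last first.
  move=> _; case: ifPn => // m0 vc; apply/ess_supP.
  have /ae_foralln vc' n : {ae mu, forall x, (abse \o (EFin \o v_ n)) x <= c}.
    exact/ess_supP/vc.
  near=> x; rewrite /=.
  have vx : v_ n x @[n --> \oo] --> (v x : R) by near: x.
  have vcx : forall n, (abse \o (EFin \o v_ n)) x <= c by near: x.
  rewrite -[leLHS]/(`|(v x)%:E|) -(cvg_lim _ (cabs _ vx))//.
  apply: lime_le; first by apply/cvg_ex; eexists; exact: cabs vx.
  exact/nearW/vcx.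
rewrite lee_fin => r1; have r0 : (0 < r)%R by exact: lt_le_trans r1.
have I0 f : 0 <= \int[mu]_x `|(f x)%:E| `^ r by apply: integral_ge0 => x _; exact: poweR_ge0.
have rK (y : \bar R) : 0 <= y -> (y `^ r) `^ r^-1 = y.
  by move=> y0; rewrite -poweRrM mulfV ?gt_eqF// poweRe1.
have rK' (y : \bar R) : 0 <= y -> (y `^ r^-1) `^ r = y.
  by move=> y0; rewrite -poweRrM mulVf ?gt_eqF// poweRe1.
move=> vc; rewrite -[leRHS]rK//; apply: gt0_ler_poweR => //.
- by rewrite invr_ge0 ltW.
- by rewrite in_itv/= I0 leey.
- by rewrite in_itv/= poweR_ge0 leey.
have {}vc n : \int[mu]_x `|(v_ n x)%:E| `^ r <= c `^ r.
  rewrite -[leLHS]rK'//; apply: gt0_ler_poweR => //; first exact: ltW.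
  - by rewrite in_itv/= poweR_ge0 leey.
  - by rewrite in_itv/= c0 leey.
  - exact: vc.
have ei0 x : 0 <= limn_einf (fun n => `|(v_ n x)%:E| `^ r).
  rewrite limn_einf_lim; apply: lime_ge; first exact: is_cvg_einfs.
  by apply: nearW => n; apply: le_ereal_inf_tmp => _ [m _ <-]; exact: poweR_ge0.
have cpow x : v_ n x @[n --> \oo] --> (v x : R) ->
    `|(v x)%:E| `^ r <= limn_einf (fun n => `|(v_ n x)%:E| `^ r).
  (* Continuity of the power is deduced from its derivative at a positive point; where the limit
     vanishes, the left side is 0. *)
  move=> h; have [v0|v0] := eqVneq (v x) 0%R.
    by rewrite v0 abse0 poweR0r ?gt_eqF.
  rewrite [leRHS](cvg_limn_einf_sup (l := `|(v x)%:E| `^ r) _).1//.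
  apply: cvg_EFin; first exact: nearW.
  apply: (@cvg_comp _ _ _ (fun n => `|v_ n x|)%R (fun y => y `^ r)%R _ (nbhs (`|v x|)%R)).
    exact: cvg_norm.
  have v0' : (0 < `|v x|)%R by rewrite normr_gt0.
  have /derivable1_diffP/differentiable_continuous := @ex_derive _ _ _ _ _ _ _ (is_derive1_powR r v0').
  exact.
have me : measurable_fun setT (fun x => limn_einf (fun n => `|(v_ n x)%:E| `^ r)).
  apply: measurableT_comp => //.
  apply: (@measurable_fun_limn_esup _ _ _ _ (fun n x => - (`|(v_ n x)%:E| `^ r))) => n.
  by apply: measurableT_comp => //; exact: mpow.
apply: (@le_trans _ _ (\int[mu]_x limn_einf (fun n => `|(v_ n x)%:E| `^ r))).
  apply: ae_ge0_le_integral => //.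
  - by move=> x _; exact: poweR_ge0.
  - exact: mpow.
  - by apply: filterS cv => x /cpow + _.
apply: le_trans (fatou _ _ _ _) _ => //.
- by move=> n; exact: mpow.
- by move=> n x _; exact: poweR_ge0.
apply: le_trans (limn_einf_sup _) _; rewrite limn_esup_lim.
apply: lime_le; first exact: is_cvg_esups.
by apply: nearW => n; apply: ge_ereal_sup => _ [m _ <-]; exact: vc.
Unshelve. all: by end_near. Qed.

(* A sum of L1 norms of increments controls the integral of the sum of their
   absolute values, which is therefore finite almost everywhere. *)
Lemma ae_cvg_of_summable (f_ : (T -> R)^nat) : (forall n, measurable_fun setT (f_ n)) ->
  \sum_(n <oo) 'N[mu]_1[EFin \o (fun x => f_ n.+1 x - f_ n x)%R] < +oo ->
  exists2 f : T -> R, measurable_fun setT f &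
    {ae mu, forall x, f_ n x @[n --> \oo] --> (f x : R)}.
Proof.
move=> mf sf.
pose df n x : \bar R := `|(f_ n.+1 x - f_ n x)%:E|.
have mdf n : measurable_fun setT (df n).
  by apply: measurableT_comp => //; apply/measurable_EFinP; exact: measurable_funB.
have mS : measurable_fun setT (fun x => \sum_(n <oo) df n x).
  by apply: (@ge0_emeasurable_sum _ _ _ _ df predT) => // k x _ _; exact: abse_ge0.
have iS : mu.-integrable setT (fun x => \sum_(n <oo) df n x).
  apply/integrableP; split => //.
  under eq_integral => x _ do rewrite gee0_abs ?(nneseries_ge0 (fun n _ _ => abse_ge0 _))//.
  rewrite integral_nneseries//; last by move=> n x _; exact: abse_ge0.
  by under eq_eseriesr do rewrite -Lnorm1.
(* The upper limit is defined and measurable everywhere, and it is the limit wherever the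
   telescoping series converges absolutely. *)
pose f x := fine (limn_esup (fun n => (f_ n x)%:E)).
exists f.
  apply: measurableT_comp => //; apply: measurable_fun_limn_esup => n.
  exact/measurable_EFinP.
apply: filterS (integrable_ae measurableT iS) => x /(_ I) Sx.
have cx : cvg (f_ n x @[n --> \oo]).
  have -> : f_ ^~ x = (fun n => f_ 0%N x + series (fun n => f_ n.+1 x - f_ n x) n)%R.
    apply/funext => n; rewrite /series /= telescope_sumr//.
    by rewrite addrC subrK.
  apply: is_cvgD; first exact: is_cvg_cst.
  apply: normed_cvg; apply: nondecreasing_is_cvgn.
    by apply: nondecreasing_series => n _ _ /=; exact: normr_ge0.
  exists (fine (\sum_(n <oo) df n x)) => _ [n _ <-].
  rewrite -lee_fin fineK// /series /= -sumEFin.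
  by apply: (@nneseries_lim_ge _ (df ^~ x)) => k _ _; exact: abse_ge0.
rewrite /f; move/cvg_ex : cx => [l fl].
have fl' : (f_ n x)%:E @[n --> \oo] --> l%:E by apply: cvg_EFin => //; exact: nearW.
by rewrite (cvg_limn_einf_sup fl').2.
Qed.

End Lnorm_facts.

(** * The algebras AC_p *)

Section Bridge.
Context {R : realType}.
Implicit Types (f g : Icc01 R -> Cplx R) (F G : R -> R).

Lemma clamp_in (t : R) : clamp t \in Icc01 R.
Proof. by rewrite inE /Icc01 /= in_itv /= clamp_itv. Qed.

Definition clampI (t : R) : Icc01 R := exist _ (clamp t) (clamp_in t).

Lemma Icc01_itv (x : Icc01 R) : 0 <= \val x <= 1.
Proof. by have := valP x; rewrite inE /Icc01 /= in_itv. Qed.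

Lemma clampI_val (x : Icc01 R) : clampI (\val x) = x.
Proof. by apply: val_inj; rewrite /= clamp_id// Icc01_itv. Qed.

Lemma clampI_clamp (t : R) : clampI (clamp t) = clampI t.
Proof. by apply: val_inj; rewrite /= clampK. Qed.

Definition reF f (t : R) : R := complex.Re (f (clampI t)).
Definition imF f (t : R) : R := complex.Im (f (clampI t)).

Lemma reF_clamp f t : reF f t = reF f (clamp t).
Proof. by rewrite /reF clampI_clamp. Qed.

Lemma imF_clamp f t : imF f t = imF f (clamp t).
Proof. by rewrite /imF clampI_clamp. Qed.

Lemma normc_le_ReIm (z : R[i]) :
  Normc.normc z <= `|complex.Re z| + `|complex.Im z|.
Proof.
case: z => a b /=; rewrite -[leRHS]ger0_norm ?addr_ge0// -sqrtr_sqr ler_wsqrtr//.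
rewrite sqrrD !real_normK ?num_real// addrAC lerDl.
by rewrite mulrn_wge0// mulr_ge0.
Qed.

Lemma Re_le_normc (z : R[i]) : `|complex.Re z| <= Normc.normc z.
Proof.
by case: z => a b /=; rewrite -sqrtr_sqr ler_wsqrtr// lerDl sqr_ge0.
Qed.

Lemma Im_le_normc (z : R[i]) : `|complex.Im z| <= Normc.normc z.
Proof.
by case: z => a b /=; rewrite -sqrtr_sqr ler_wsqrtr// lerDr sqr_ge0.
Qed.

Lemma abs_continuous_AC f : abs_continuous f -> AC (reF f) /\ AC (imF f).
Proof.
move=> fac; suff H e : 0 < e -> exists2 d : R, 0 < d & forall l, nonoverlap l ->
    incr id l < d ->
    \sum_(p <- l) Normc.normc (f (clampI p.2) - f (clampI p.1)) < e.
  split => e /H[d d0 dP]; exists d => // l nl ld; apply: le_lt_trans (dP l nl ld).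
    apply: ler_sum => p _; rewrite /reF.
    by apply: le_trans (Re_le_normc _); rewrite raddfB.
  apply: ler_sum => p _; rewrite /imF.
  by apply: le_trans (Im_le_normc _); rewrite raddfB.
move=> /fac[d d0 dP]; exists d => // l nl ld.
pose x0 : R * R := (0, 0).
pose a (i : 'I_(size l)) := clampI (nth x0 l i).1.
pose b (i : 'I_(size l)) := clampI (nth x0 l i).2.
have [l1 /(pairwiseP x0) l2] := andP nl.
have l12 (i : nat) : (i < size l)%N -> (nth x0 l i).1 <= (nth x0 l i).2.
  by move=> il; apply: (allP l1); exact: mem_nth.
rewrite (big_nth x0) big_mkord; apply: (dP _ a b).
- by move=> i; apply: clamp_homo; exact: l12.
(* Since [clamp] is monotone, separated intervals have clamped images with disjoint interiors. *)
- suff W (i j : 'I_(size l)) : (i < j)%N ->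
      ~ (`]\val (a i), \val (b i)[%classic `&` `]\val (a j), \val (b j)[%classic !=set0).
    move=> i j _ _ ij; apply: val_inj; case: (ltngtP i j) => // h.
      by have := W _ _ h ij.
    by have := W _ _ h; rewrite setIC => /(_ ij).
  move=> ij [t []] /=; rewrite !in_itv/= => /andP[ai bi] /andP[aj bj].
  have /orP[/clamp_homo|/clamp_homo] := l2 _ _ (ltn_ord i) (ltn_ord j) ij.
    by move=> /(lt_le_trans bi) /lt_trans /(_ aj); rewrite ltxx.
  by move=> /(lt_le_trans bj) /lt_trans /(_ ai); rewrite ltxx.
- apply: le_lt_trans ld; rewrite /incr (big_nth x0) big_mkord.
  by apply: ler_sum => i _; apply: clamp_lip; exact: l12.
Qed.

Lemma AC_abs_continuous f : AC (reF f) -> AC (imF f) -> abs_continuous f.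
Proof.
move=> reA imA e e0; have e20 : 0 < e / 2 by rewrite divr_gt0.
have [d1 d10 d1P] := reA _ e20; have [d2 d20 d2P] := imA _ e20.
exists (Num.min d1 d2); first by rewrite lt_min d10.
move=> n a b ab tab sd.
(* Degenerate intervals are discarded: the open interval is then empty, so [trivIset] does not
   prevent it from sitting inside another interval, which [sep] forbids. They contribute nothing to
   either sum. *)
pose P (i : 'I_n) := \val (a i) < \val (b i).
pose l := [seq (\val (a i), \val (b i)) | i <- enum 'I_n & P i].
have sumE (K : R -> R -> R) : (forall t, K t t = 0) ->
    \sum_(p <- l) K p.1 p.2 = \sum_(i < n) K (\val (a i)) (\val (b i)).
  move=> K0; rewrite big_map big_filter big_enum_cond/= big_mkcond/=.
  apply: eq_bigr => i _; case: ifPn => //; rewrite /P -leNgt => ba.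
  by have -> : \val (b i) = \val (a i) by apply/eqP; rewrite eq_le ba ab.
have nl : nonoverlap l.
  apply/andP; split.
    by apply/allP => _ /mapP[i _ ->] /=; exact: ab.
  rewrite /l pairwise_map.
  have : pairwise [rel i j | i != j] [seq i <- enum 'I_n | P i].
    by rewrite -uniq_pairwise filter_uniq// enum_uniq.
  apply: (sub_in_pairwise (P := P)); last by apply/allP => i; rewrite mem_filter => /andP[].
  move=> i j Pi Pj /=; apply: contraR; rewrite /sep /= negb_or -!ltNge => /andP[aj ai].
  apply/eqP/tab => //.
  pose c := Num.max (\val (a i)) (\val (a j)); pose d := Num.min (\val (b i)) (\val (b j)).
  have cd : c < d by rewrite /c /d gt_max !lt_min ai aj [_ < _]Pi [_ < _]Pj.
  exists ((c + d) / 2); split; rewrite /= in_itv/=; apply/andP; split.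
  - by apply: (@le_lt_trans _ _ c); rewrite ?le_max ?lexx//; rewrite midf_lt.
  - by apply: (@lt_le_trans _ _ d); rewrite ?ge_min ?lexx//; rewrite midf_lt.
  - by apply: (@le_lt_trans _ _ c); rewrite ?le_max ?lexx ?orbT//; rewrite midf_lt.
  - by apply: (@lt_le_trans _ _ d); rewrite ?ge_min ?lexx ?orbT//; rewrite midf_lt.
have ll : incr id l < Num.min d1 d2.
  by rewrite /incr (sumE (fun x y => y - x)) // => t; rewrite subrr.
move: ll; rewrite lt_min => /andP[/(d1P _ nl) s1 /(d2P _ nl) s2].
have := ltrD s1 s2; rewrite -splitr; apply: le_lt_trans.
rewrite /absincr (sumE (fun x y => `|reF f y - reF f x|)); last first.
  by move=> t; rewrite subrr normr0.
rewrite (sumE (fun x y => `|imF f y - imF f x|)); last first.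
  by move=> t; rewrite subrr normr0.
rewrite -big_split; apply: ler_sum => i _ /=.
by apply: le_trans (normc_le_ReIm _) _; rewrite /reF /imF !clampI_val !raddfB.
Qed.

Lemma valL_clampI f (t : R) : 0 <= t <= 1 -> 'valL_ 0 f t = f (clampI t).
Proof.
move=> t01; rewrite /valL_ /= oinv_set_val.
have tI : t \in Icc01 R by rewrite inE /Icc01 /= in_itv.
case: insubP => [u _ /= ut|]; last by rewrite tI.
by congr f; apply: val_inj; rewrite /= clamp_id.
Qed.

Lemma valL_out f (t : R) : ~~ (0 <= t <= 1) -> 'valL_ 0 f t = 0.
Proof.
move=> t01; rewrite /valL_ /= oinv_set_val insubF//.
by apply/negP; rewrite inE /Icc01 /= in_itv/= (negbTE t01).
Qed.

Lemma near_eq_derive1 F G (x : R) : (\near x, F x = G x) -> derive1 F x = derive1 G x.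
Proof. by move=> FG; rewrite !derive1E; exact: near_eq_derive. Qed.

Lemma near_itv01 (x : R) : 0 < x < 1 -> \near x, 0 <= x <= 1.
Proof.
move=> x01; have : x \in `]0, 1[%R by rewrite in_itv.
move=> /near_in_itvoo; apply: filterS => y; rewrite in_itv/= => /andP[y0 y1].
by rewrite !ltW.
Qed.

Lemma near_out01 (x : R) : ~~ (0 <= x <= 1) -> \near x, ~~ (0 <= x <= 1).
Proof.
rewrite negb_and -!ltNge => /orP[x0|x1].
- have : \near x, x < 0 by apply: lt_nbhsl.
  by apply: filterS => y y0; rewrite negb_and -ltNge y0.
- have : \near x, 1 < x by apply: lt_nbhsr.
  by apply: filterS => y y0; rewrite negb_and -!ltNge y0 orbT.
Qed.

(* Derivative of the extension of f by constants.  Unlike [cderiv], it is the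
   derivative of a function which is absolutely continuous on the whole line;
   the two agree inside ]0, 1[. *)
Definition Dc f (x : R) : Cplx R := Complex (derive1 (reF f) x) (derive1 (imF f) x).

Lemma cderiv_in f x : 0 < x < 1 -> cderiv f x = Dc f x.
Proof.
move=> x01; rewrite /cderiv /Dc; congr Complex; apply: near_eq_derive1;
  by apply: filterS (near_itv01 x01) => y y01; rewrite valL_clampI.
Qed.

Lemma cderiv_out f x : ~~ (0 <= x <= 1) -> cderiv f x = 0.
Proof.
move=> x01; rewrite /cderiv -[RHS]/(Complex 0 0); congr Complex.
  rewrite (near_eq_derive1 (G := cst 0)) ?derive1_cst//.
  by apply: filterS (near_out01 x01) => y y01; rewrite valL_out.
rewrite (near_eq_derive1 (G := cst 0)) ?derive1_cst//.
by apply: filterS (near_out01 x01) => y y01; rewrite valL_out.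
Qed.

(** Meant for the two parts of [cderiv], whose values at 0 and 1 are uncontrolled; singletons do not
    affect measurability. *)
Lemma measurable_patch01 (h k : R -> R) : measurable_fun setT k ->
  (forall x, 0 < x < 1 -> h x = k x) -> (forall x, ~~ (0 <= x <= 1) -> h x = 0) ->
  measurable_fun setT h.
Proof.
move=> mk hk h0.
have -> : [set: R] = `]0, 1[%classic `|` ([set 0] `|` ([set 1] `|` ~` `[0, 1]%classic)).
  apply/seteqP; split => // x _ /=; rewrite !in_itv/=.
  have [x0|x0|<-] := ltgtP 0 x; last by right; left.
    have [x1|x1|->] := ltgtP x 1; first by left.
      by right; right; right.
    by right; right; left.
  by right; right; right.
apply/measurable_funU => //.
  by apply: measurableU => //; apply: measurableU => //; apply: measurableC.
split.
  apply: (eq_measurable_fun k) => [x|]; last exact: measurable_funTS.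
  by rewrite inE/= in_itv/= => /hk.
apply/measurable_funU => //; first by apply: measurableU => //; apply: measurableC.
split; first exact: measurable_fun_set1.
apply/measurable_funU => //; first by apply: measurableC.
split; first exact: measurable_fun_set1.
apply: (eq_measurable_fun (fun _ => 0 : R)) => [x|]; last exact: measurable_cst.
by rewrite inE/= in_itv/= => /negP/h0.
Qed.

End Bridge.

(** * Almost everywhere statements and Lebesgue measure on [0, 1] *)

Section AlmostEverywhere.
Context d (T : measurableType d) (R : realType).
Variable mu : {measure set T -> \bar R}.
Implicit Types P Q S : T -> Prop.

Lemma ae_imp P Q : (forall x, P x -> Q x) ->
  {ae mu, forall x, P x} -> {ae mu, forall x, Q x}.
Proof. exact: filterS. Qed.

Lemma ae_imp2 P Q S : (forall x, P x -> Q x -> S x) ->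
  {ae mu, forall x, P x} -> {ae mu, forall x, Q x} -> {ae mu, forall x, S x}.
Proof. exact: filterS2. Qed.

End AlmostEverywhere.

Section Lebesgue01.
Context {R : realType}.
Local Notation leb := (@lebesgue_measure R).
Local Notation leb01 := (@lebesgue01 R).

Lemma lebesgue01T : leb01 setT = 1%E.
Proof.
rewrite /lebesgue01 /= /mrestr setTI lebesgue_measure_itv /= lte01.
by rewrite -EFinB subr0.
Qed.

(** The exceptional set absorbs the complement of [0, 1], which [lebesgue01] does not charge, and
    the two endpoints, where [cderiv] and [Dc] may differ. *)
Lemma ae_lebesgue01 (P : R -> Prop) :
  {ae leb, forall x, 0 < x < 1 -> P x} -> {ae leb01, forall x, P x}.
Proof.
move=> [A [mA A0 AP]].
have m0 : measurable ([set 0; 1] : set (measurableTypeR R)).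
  by apply: measurableU; exact: (@measurable_set1 R).
have mI : measurable (~` Icc01 R : set (measurableTypeR R)).
  by apply: measurableC; exact: (@measurable_itv R).
exists ((A `|` [set 0; 1]) `|` ~` Icc01 R); split.
- by apply: measurableU => //; apply: measurableU.
- rewrite /lebesgue01 /= /mrestr setIUl setICl setU0.
  apply: (@subset_measure0 _ _ _ leb _ (A `|` [set 0; 1])) => //.
  + by apply: measurableI; [exact: measurableU|exact: (@measurable_itv R)].
  + exact: measurableU.
  + apply/eqP; rewrite eq_le measure_ge0 andbT.
    apply: le_trans (measureU2 _ _ _) _ => //.
    rewrite -[leRHS](adde0 0%E); apply: leeD.
      by rewrite le_eqVlt; apply/orP; left; apply/eqP; exact: A0.
    rewrite le_eqVlt; apply/orP; left; apply/eqP.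
    by apply: countable_lebesgue_measure0; apply: finite_set_countable.
- move=> x /= nP; have [xI|xI] := pselect (Icc01 R x); last by right.
  left; have [xA|nA] := pselect (A x); first by left.
  right; have [x01|] := boolP (0 < x < 1).
    by exfalso; apply: nA; apply: AP => /= /(_ x01).
  move: xI; rewrite /Icc01 /= in_itv/= => /andP[x0 x1].
  rewrite negb_and -!leNgt => /orP[xx|xx].
    by left; apply/eqP; rewrite eq_le xx x0.
  by right; apply/eqP; rewrite eq_le xx x1.
Qed.

Lemma ae_lebesgue01_lebesgue (P : R -> Prop) :
  {ae leb01, forall x, P x} -> {ae leb, forall x, 0 <= x <= 1 -> P x}.
Proof.
move=> [A [mA A0 AP]]; exists (A `&` Icc01 R); split => //.
  by apply: measurableI => //; exact: (@measurable_itv R).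
move=> x /= /not_implyP[/andP[x0 x1] nP]; split; first exact: AP.
by rewrite /Icc01 /= in_itv/= x0 x1.
Qed.

Lemma integral_lebesgue01 (f : R -> \bar R) : measurable_fun setT f ->
  (forall x, 0 <= f x)%E ->
  (\int[leb01]_x f x = \int[leb]_(x in Icc01 R) f x)%E.
Proof.
move=> mf f0; have mI : measurable (Icc01 R : set (measurableTypeR R)).
  exact: (@measurable_itv R).
rewrite (@ge0_negligible_integral _ _ _ leb01 _ (~` Icc01 R))//; last 2 first.
- exact: measurableC.
- by rewrite /lebesgue01 /= /mrestr setICl measure0.
rewrite setTD setCK; apply: eq_measure_integral => A mA AI.
by rewrite /lebesgue01 /= /mrestr; congr (leb _); exact/setIidPl.
Qed.

End Lebesgue01.

(** * The derivative as density *)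

Section FTC.
Context {R : realType}.
Local Notation leb := (@lebesgue_measure R).
Implicit Types (F g : R -> R).

Lemma AC_derivable F : AC F -> (forall t, F t = F (clamp t)) ->
  {ae leb, forall x, derivable F x 1}.
Proof.
move=> aF F01; have [g ig Fg] := AC_density aF F01.
apply: (ae_imp _ (primitive_derive ig)) => x [dx _].
have -> : F = cst (F 0) + primitive g by apply/funext => t; exact: Fg.
exact: derivableD.
Qed.

Lemma AC_derive1_measurable F : AC F -> measurable_fun setT (derive1 F).
Proof. by move=> aF; apply: derive1_measurable; exact: AC_continuous. Qed.

(** [derive1 F] agrees almost everywhere with the abstract density and is itself measurable, so it
    can replace the density under the integral. *)
Let ftc F : AC F -> (forall t, F t = F (clamp t)) ->
  leb.-integrable setT (EFin \o derive1 F) /\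
  forall x, F x = F 0 + primitive (derive1 F) x.
Proof.
move=> aF F01; have [g ig Fg] := AC_density aF F01.
have mF := AC_derive1_measurable aF.
have /integrableP[/measurable_EFinP mg goo] := ig.
have E : {ae leb, forall x, derive1 F x = g x}.
  apply: (ae_imp _ (primitive_derive ig)) => x [dx gx].
  have -> : F = cst (F 0) + primitive g by apply/funext => t; exact: Fg.
  by rewrite derive1E deriveD// derive_cst add0r -derive1E.
split.
  apply/integrableP; split; first exact/measurable_EFinP.
  apply: le_lt_trans goo; rewrite le_eqVlt; apply/orP; left; apply/eqP.
  apply: ae_eq_integral => //.
  - by apply: measurableT_comp => //; exact/measurable_EFinP.
  - by apply: measurableT_comp => //; exact/measurable_EFinP.
  - by apply: (ae_imp _ E) => x /= -> _.
move=> x; rewrite [LHS]Fg; congr (_ + _); rewrite /primitive /Rintegral; congr fine.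
apply: ae_eq_integral => //.
- by apply: measurable_funTS; exact/measurable_EFinP.
- by apply: measurable_funTS; exact/measurable_EFinP.
- by apply: (ae_imp _ E) => y /= -> _.
Qed.

Lemma AC_integrable F : AC F -> (forall t, F t = F (clamp t)) ->
  leb.-integrable setT (EFin \o derive1 F).
Proof. by move=> aF F01; have [] := ftc aF F01. Qed.

Lemma AC_FTC F x : AC F -> (forall t, F t = F (clamp t)) -> 0 <= x ->
  F x - F 0 = \int[leb]_(t in `]0, x]) derive1 F t.
Proof.
move=> aF F01 x0; have [iF FE] := ftc aF F01.
have p0 : primitive (derive1 F) 0 = 0 by have := FE 0; lra.
by rewrite -primitiveB// (FE x) p0; ring.
Qed.

Lemma primitive_clamp_AC g : leb.-integrable setT (EFin \o g) ->
  AC (primitive g \o clamp).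
Proof. by move=> ig; apply/AC_clamp/primitive_AC. Qed.

Lemma primitive_clamp_derive1 g : leb.-integrable setT (EFin \o g) ->
  {ae leb, forall x, 0 < x < 1 -> derive1 (primitive g \o clamp) x = g x}.
Proof.
move=> ig; apply: (ae_imp _ (primitive_derive ig)) => x [_ <-] x01.
apply: near_eq_derive1; apply: filterS (near_itv01 x01) => y y01 /=.
by rewrite clamp_id.
Qed.

End FTC.

(** * Lp seminorms of complex functions on [0, 1] *)

Section ComplexLp.
Context {R : realType}.
Local Notation leb01 := (@lebesgue01 R).
Local Notation normc := (@Normc.normc R).
Implicit Types (g h : R -> Cplx R) (p : \bar R).

Definition cmeasurable g := measurable_fun setT (fun x => complex.Re (g x)) /\
  measurable_fun setT (fun x => complex.Im (g x)).

Lemma normc_ge0 (z : R[i]) : 0 <= normc z.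
Proof. by case: z => a b; exact: sqrtr_ge0. Qed.

Lemma normcE (z : R[i]) : normc z = Num.sqrt (complex.Re z ^+ 2 + complex.Im z ^+ 2).
Proof. by case: z. Qed.

Lemma measurable_normc g : cmeasurable g -> measurable_fun setT (fun x => normc (g x)).
Proof.
move=> [mr mi]; under eq_fun do rewrite normcE.
apply: (measurableT_comp (f := @Num.sqrt R)).
  by apply: continuous_measurable_fun; exact: sqrt_continuous.
by apply: measurable_funD; exact: measurable_funX.
Qed.

Lemma cLp_le p g h : (1 <= p)%E -> cmeasurable g -> cmeasurable h ->
  {ae leb01, forall x, normc (g x) <= normc (h x)} -> (LpnormE p g <= LpnormE p h)%E.
Proof.
move=> p1 mg mh gh; apply: le_ae_Lnorm => //; try exact: measurable_normc.
by apply: (ae_imp _ gh) => x; rewrite !ger0_norm ?normc_ge0.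
Qed.

Lemma cLp_eq p g h : (1 <= p)%E -> cmeasurable g -> cmeasurable h ->
  {ae leb01, forall x, g x = h x} -> LpnormE p g = LpnormE p h.
Proof.
move=> p1 mg mh gh; apply/eqP; rewrite eq_le !cLp_le//.
  by apply: (ae_imp _ gh) => x ->.
by apply: (ae_imp _ gh) => x ->.
Qed.

Lemma cLp_dom p (K1 K2 : R) g h1 h2 : (1 <= p)%E -> 0 <= K1 -> 0 <= K2 ->
  cmeasurable g -> cmeasurable h1 -> cmeasurable h2 ->
  {ae leb01, forall x, normc (g x) <= K1 * normc (h1 x) + K2 * normc (h2 x)} ->
  (LpnormE p g <= K1%:E * LpnormE p h1 + K2%:E * LpnormE p h2)%E.
Proof.
move=> p1 K10 K20 /measurable_normc mg /measurable_normc m1 /measurable_normc m2 gh.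
pose k1 x := K1 * normc (h1 x); pose k2 x := K2 * normc (h2 x).
have mk1 : measurable_fun setT k1 by exact: measurable_funM.
have mk2 : measurable_fun setT k2 by exact: measurable_funM.
apply: (@le_trans _ _ ('N[leb01]_p[EFin \o (k1 \+ k2)%R])%E).
  apply: le_ae_Lnorm => //; first exact: measurable_funD.
  apply: (ae_imp _ gh) => x; rewrite ger0_norm ?normc_ge0//.
  by move=> /le_trans; apply; exact: ler_norm.
apply: (le_trans (@eminkowski _ _ _ leb01 k1 k2 p mk1 mk2 p1)).
rewrite (@Lnorm_scale _ _ _ leb01 p (fun x => normc (h1 x)) K1)//.
rewrite (@Lnorm_scale _ _ _ leb01 p (fun x => normc (h2 x)) K2)//.
by rewrite !ger0_norm.
Qed.

Lemma cmeasurableM (c : R[i]) g : cmeasurable g -> cmeasurable (fun x => c * g x).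
Proof.
case: c => a b [mR mI]; split.
  rewrite (_ : (fun _ => _) = (fun x => a * complex.Re (g x) - b * complex.Im (g x))).
    by apply: measurable_funB; exact: measurable_funM.
  by apply/funext => x; case: (g x).
rewrite (_ : (fun _ => _) = (fun x => a * complex.Im (g x) + b * complex.Re (g x))).
  by apply: measurable_funD; exact: measurable_funM.
by apply/funext => x; case: (g x).
Qed.

Lemma cmeasurableB g h : cmeasurable g -> cmeasurable h ->
  cmeasurable (fun x => g x - h x).
Proof.
move=> [mR mI] [mR' mI']; split; under eq_fun do rewrite raddfB.
  exact: measurable_funB.
exact: measurable_funB.
Qed.

Lemma cLp_scale p (c : R[i]) g : (1 <= p)%E -> cmeasurable g ->
  LpnormE p (fun x => c * g x) = ((normc c)%:E * LpnormE p g)%E.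
Proof.
move=> p1 /measurable_normc mg; rewrite /LpnormE.
under [X in Lnorm _ _ X]eq_fun do rewrite Normc.normcM.
by rewrite (@Lnorm_scale _ _ _ leb01 p (fun x => normc (g x)) (normc c))// ger0_norm// normc_ge0.
Qed.

Lemma cLp1_le p g : (1 <= p)%E -> cmeasurable g -> (LpnormE 1%E g <= LpnormE p g)%E.
Proof.
by move=> p1 /measurable_normc mg; apply: Lnorm1_le => //; exact: lebesgue01T.
Qed.

Lemma cLp_ge0 p g : (0 <= LpnormE p g)%E.
Proof. exact: Lnorm_ge0. Qed.

End ComplexLp.

(** * Complex absolutely continuous functions and their derivatives *)

Section ACFunctions.
Context {R : realType}.
Local Notation leb01 := (@lebesgue01 R).
Local Notation normc := (@Normc.normc R).
Implicit Types (f g h : Icc01 R -> Cplx R) (F G : R -> R) (p : \bar R).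

Definition cAC f := AC (reF f) /\ AC (imF f).

Lemma cAC_measurable f : cAC f -> cmeasurable (Dc f).
Proof. by move=> [aR aI]; split; exact: AC_derive1_measurable. Qed.

Lemma cderiv_ae f : {ae leb01, forall x, cderiv f x = Dc f x}.
Proof.
apply: ae_lebesgue01; apply: aeW => x x01; exact: cderiv_in.
Qed.

Lemma cderiv_measurable f : cAC f -> cmeasurable (cderiv f).
Proof.
move=> /cAC_measurable[mR mI]; split.
- apply: (measurable_patch01 mR) => x x01; first by rewrite cderiv_in.
  by rewrite cderiv_out.
- apply: (measurable_patch01 mI) => x x01; first by rewrite cderiv_in.
  by rewrite cderiv_out.
Qed.

Lemma LpnormE_cderiv p f : (1 <= p)%E -> cAC f -> LpnormE p (cderiv f) = LpnormE p (Dc f).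
Proof.
move=> p1 cf; apply: cLp_eq => //; [exact: cderiv_measurable|exact: cAC_measurable|].
exact: cderiv_ae.
Qed.

(** Working form of membership: [Dc] and [cderiv] agree almost everywhere, and absolute continuity
    already makes [cderiv f] measurable. *)
Lemma ACpP p f : (1 <= p)%E -> ACp p f <->
  [/\ cAC f, f (clampI 0) = 0 & (LpnormE p (Dc f) < +oo)%E].
Proof.
have c0 : \val (clampI (0 : R)) = 0 by rewrite /= clamp_id// lexx ler01.
move=> p1; split=> [[/abs_continuous_AC cf f0 [_ _ fp]]|[cf f0 fp]].
  by split => //; [exact: f0|rewrite -LpnormE_cderiv].
have [mR mI] := cderiv_measurable cf.
split; first by case: cf => *; exact: AC_abs_continuous.
- by move=> x x0; rewrite -(clampI_val x) x0.
- split; [exact: measurable_funTS|exact: measurable_funTS|].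
  by rewrite LpnormE_cderiv.
Qed.

Lemma ACp_normE p f : (1 <= p)%E -> ACp p f -> (ACp_norm p f)%:E = LpnormE p (Dc f).
Proof.
move=> p1 /(ACpP f p1)[cf _ fp]; rewrite /ACp_norm LpnormE_cderiv// fineK//.
by rewrite ge0_fin_numE// cLp_ge0.
Qed.

(** [incr_bounded] is used for [F] and for its opposite, on the single interval from 0 to
    [clamp t]. *)
Lemma AC_bounded F : AC F -> (forall t, F t = F (clamp t)) ->
  exists M : R, forall t, `|F t| <= M.
Proof.
move=> aF F01; have [M MP] := incr_bounded aF F01.
have aN : AC (fun t => -1 * F t) by exact: ACZ.
have [M' M'P] := incr_bounded aN (fun t => congr1 (fun y => -1 * y) (F01 t)).
exists (`|F 0| + `|M| + `|M'|) => t; rewrite F01.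
have /andP[c0 c1] := clamp_itv t.
have fam : nonoverlap [:: (0, clamp t)] by rewrite /nonoverlap /= c0.
have := MP _ fam; have := M'P _ fam; rewrite /incr !big_seq1/= => H1 H2.
rewrite -[X in `|X|](subrK (F 0)) (le_trans (ler_normD _ _))// addrC -addrA lerD2l.
have := ler_norm M; have := ler_norm M'.
by have := normr_ge0 M; have := normr_ge0 M'; rewrite ler_norml; lra.
Qed.

Lemma cAC_bounded f : cAC f -> exists2 M : R, 0 <= M & forall x, normc (f x) <= M.
Proof.
move=> [aR aI]; have [M MP] := AC_bounded aR (reF_clamp f).
have [M' M'P] := AC_bounded aI (imF_clamp f).
exists (M + M') => [|x].
  by rewrite addr_ge0// (le_trans (normr_ge0 _) (MP 0), le_trans (normr_ge0 _) (M'P 0)).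
rewrite (le_trans (normc_le_ReIm _))// lerD//.
  by have := MP (\val x); rewrite /reF clampI_val.
by have := M'P (\val x); rewrite /imF clampI_val.
Qed.

Lemma cAC_derivable f : cAC f ->
  {ae leb01, forall x, derivable (reF f) x 1 /\ derivable (imF f) x 1}.
Proof.
move=> [aR aI]; apply: ae_lebesgue01.
apply: (ae_imp2 _ (AC_derivable aR (reF_clamp f)) (AC_derivable aI (imF_clamp f))).
by move=> x dR dI _.
Qed.

Lemma derivable_is_derive F x : derivable F x 1 -> is_derive x 1 F (derive1 F x).
Proof. by move=> dF; apply: DeriveDef => //; rewrite derive1E. Qed.

Lemma reF_mul f g : reF (f * g) = reF f * reF g - imF f * imF g.
Proof.
apply/funext => t; rewrite /reF /imF /= !fctE.
by case: (f _) => a b; case: (g _).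
Qed.

Lemma imF_mul f g : imF (f * g) = reF f * imF g + imF f * reF g.
Proof.
apply/funext => t; rewrite /reF /imF /= !fctE.
by case: (f _) => a b; case: (g _).
Qed.

Lemma reF_add f g : reF (f + g) = reF f + reF g.
Proof. by apply/funext => t; rewrite /reF /= !fctE raddfD. Qed.

Lemma imF_add f g : imF (f + g) = imF f + imF g.
Proof. by apply/funext => t; rewrite /imF /= !fctE raddfD. Qed.

Lemma cAC_add f g : cAC f -> cAC g -> cAC (f + g).
Proof.
by move=> [aR aI] [bR bI]; split; rewrite ?reF_add ?imF_add; exact: ACD.
Qed.

Lemma cAC_mul f g : cAC f -> cAC g -> cAC (f * g).
Proof.
move=> cf cg; have [M M0 MP] := cAC_bounded cf; have [M' M'0 M'P] := cAC_bounded cg.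
have bR t : `|reF f t| <= M + M'.
  by rewrite (le_trans (Re_le_normc _))// (le_trans (MP _))// lerDl.
have bI t : `|imF f t| <= M + M'.
  by rewrite (le_trans (Im_le_normc _))// (le_trans (MP _))// lerDl.
have cR t : `|reF g t| <= M + M'.
  by rewrite (le_trans (Re_le_normc _))// (le_trans (M'P _))// lerDr.
have cI t : `|imF g t| <= M + M'.
  by rewrite (le_trans (Im_le_normc _))// (le_trans (M'P _))// lerDr.
case: cf => aR aI; case: cg => aR' aI'.
split; rewrite ?reF_mul ?imF_mul.
  by apply: ACB; [exact: (ACM bR cR)|exact: (ACM bI cI)].
by apply: ACD; [exact: (ACM bR cI)|exact: (ACM bI cR)].
Qed.

Lemma cAC_cst (c : Cplx R) : cAC (fun=> c).
Proof.
split; apply: (AC_lip (K := 0)) => x y; rewrite /reF /imF subrr normr0 mul0r//.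
Qed.

Lemma Dc_cst (c : Cplx R) x : Dc (fun=> c) x = 0.
Proof. by rewrite /Dc /reF /imF !derive1_cst. Qed.

Lemma Dc_add f g : cAC f -> cAC g ->
  {ae leb01, forall x, Dc (f + g) x = Dc f x + Dc g x}.
Proof.
move=> cf cg; apply: (ae_imp2 _ (cAC_derivable cf) (cAC_derivable cg)).
move=> x [/derivable_is_derive d1 /derivable_is_derive d2].
move=> [/derivable_is_derive d3 /derivable_is_derive d4].
transitivity (Complex (derive1 (reF f) x + derive1 (reF g) x)
  (derive1 (imF f) x + derive1 (imF g) x)); last by [].
by rewrite /Dc reF_add imF_add; congr Complex; rewrite [LHS]derive1E; apply: derive_val.
Qed.

Lemma Dc_mul f g : cAC f -> cAC g ->
  {ae leb01, forall x, Dc (f * g) x = Dc f x * g (clampI x) + f (clampI x) * Dc g x}.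
Proof.
move=> cf cg; apply: (ae_imp2 _ (cAC_derivable cf) (cAC_derivable cg)).
move=> x [/derivable_is_derive d1 /derivable_is_derive d2].
move=> [/derivable_is_derive d3 /derivable_is_derive d4].
rewrite /Dc reF_mul imF_mul.
have -> : derive1 (reF f * reF g - imF f * imF g) x =
    reF f x *: derive1 (reF g) x + reF g x *: derive1 (reF f) x -
    (imF f x *: derive1 (imF g) x + imF g x *: derive1 (imF f) x).
  by rewrite [LHS]derive1E; apply: derive_val.
have -> : derive1 (reF f * imF g + imF f * reF g) x =
    reF f x *: derive1 (imF g) x + imF g x *: derive1 (reF f) x +
    (imF f x *: derive1 (reF g) x + reF g x *: derive1 (imF f) x).
  by rewrite [LHS]derive1E; apply: derive_val.
rewrite /reF /imF; case: (f (clampI x)) => a b; case: (g (clampI x)) => c d /=.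
set u1 := derive1 _ _; set u2 := derive1 _ _; set u3 := derive1 _ _; set u4 := derive1 _ _.
rewrite /GRing.scale /=.
by congr Complex; ring.
Qed.

End ACFunctions.

(** * Sup bounds and algebra operations *)

Section Algebra.
Context {R : realType}.
Local Notation leb := (@lebesgue_measure R).
Local Notation leb01 := (@lebesgue01 R).
Local Notation normc := (@Normc.normc R).
Implicit Types (f g h : Icc01 R -> Cplx R) (F G : R -> R) (p : \bar R).

Lemma le_AC_integral F x : AC F -> (forall t, F t = F (clamp t)) -> 0 <= x ->
  ((`|F x - F 0|%R)%:E <= \int[leb]_(t in `]0%R, x]) (`|derive1 F t|%R)%:E)%E.
Proof.
move=> aF F01 x0; have iF := AC_integrable aF F01.
have iFx : leb.-integrable `]0, x]%classic (EFin \o derive1 F).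
  by apply: integrableS iF => //; exact: (@measurable_itv R).
rewrite (AC_FTC aF F01 x0); apply: (@le_trans _ _ `|\int[leb]_(t in `]0%R, x]) (EFin \o derive1 F) t|%E).
  rewrite /Rintegral -[leRHS]fineK; last first.
    by rewrite fin_num_abs abse_id -fin_num_abs; exact: integrable_fin_num.
  by rewrite lee_fin -fine_abse //; exact: integrable_fin_num.
apply: (le_trans (le_abse_integral _ _ _)) => //.
by case/integrableP: iFx.
Qed.

Lemma measurable_Dc f : cAC f -> measurable_fun setT (fun t => (normc (Dc f t))%:E).
Proof. by move=> cf; apply/measurable_EFinP; exact: measurable_normc (cAC_measurable cf). Qed.

(** The integral is kept local to []0, x]]: besides the global sup bound, it yields the factor x for
    p = oo and the control of f near 0 for the cutoffs. *)
Lemma le_normc_integral f (x : Icc01 R) : cAC f -> f (clampI 0) = 0 ->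
  ((normc (f x))%:E <=
   2%:E * \int[leb]_(t in `]0%R, (\val x)]) (normc (Dc f t))%:E)%E.
Proof.
move=> cf f0; have [aR aI] := cf; have /andP[x0 x1] := Icc01_itv x.
have mD : measurable_fun `]0, (\val x)]%classic (fun t => (normc (Dc f t))%:E).
  by apply: measurable_funTS; exact: measurable_Dc.
have m0 : measurable (`]0, (\val x)]%classic : set (measurableTypeR R)).
  exact: (@measurable_itv R).
have hR := le_AC_integral aR (reF_clamp f) x0.
have hI := le_AC_integral aI (imF_clamp f) x0.
rewrite {1}/reF {1}/reF clampI_val f0 subr0 in hR.
rewrite {1}/imF {1}/imF clampI_val f0 subr0 in hI.
have R0 : (0 <= \int[leb]_(t in `]0%R, (\val x)]) (normc (Dc f t))%:E)%E.
  by apply: integral_ge0 => t _; rewrite lee_fin normc_ge0.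
apply: (@le_trans _ _ ((`|complex.Re (f x)|%R)%:E + (`|complex.Im (f x)|%R)%:E)%E).
  by rewrite -EFinD lee_fin normc_le_ReIm.
rewrite -[2%R]/(1 + 1)%R EFinD ge0_muleDl ?lee_fin// mul1e.
have mabs F : AC F -> measurable_fun `]0, (\val x)]%classic (fun t => (`|derive1 F t|%R)%:E).
  move=> aF; apply: measurable_funTS; apply/measurable_EFinP.
  by apply: measurableT_comp => //; exact: AC_derive1_measurable.
apply: leeD.
  apply: (le_trans hR); apply: ge0_le_integral => //.
  - exact: mabs.
  - by move=> t _; rewrite lee_fin; exact: (Re_le_normc (Dc f t)).
apply: (le_trans hI); apply: ge0_le_integral => //.
- exact: mabs.
- by move=> t _; rewrite lee_fin; exact: (Im_le_normc (Dc f t)).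
Qed.

Lemma le_normc_LpnormE p f (x : Icc01 R) : (1 <= p)%E -> cAC f -> f (clampI 0) = 0 ->
  ((normc (f x))%:E <= 2%:E * LpnormE p (Dc f))%E.
Proof.
move=> p1 cf f0; apply: (le_trans (le_normc_integral x cf f0)).
apply: lee_wpmul2l => //; apply: le_trans (cLp1_le p1 (cAC_measurable cf)).
rewrite /LpnormE Lnorm1.
under [leRHS]eq_integral do rewrite gee0_abs ?lee_fin ?normc_ge0//.
rewrite integral_lebesgue01; last 2 first.
- exact: measurable_Dc.
- by move=> t; rewrite lee_fin normc_ge0.
apply: ge0_subset_integral.
- exact: (@measurable_itv R).
- exact: (@measurable_itv R).
- by apply: measurable_funTS; exact: measurable_Dc.
- by move=> t _; rewrite lee_fin normc_ge0.
- move=> t; rewrite /Icc01 /= !in_itv/= => /andP[/ltW -> tx] /=.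
  by apply: (le_trans tx); case/andP: (Icc01_itv x).
Qed.

Lemma le_normc_ACp_norm p f x : (1 <= p)%E -> ACp p f -> normc (f x) <= 2 * ACp_norm p f.
Proof.
move=> p1 fp; have [cf f0 _] := (ACpP f p1).1 fp.
by rewrite -lee_fin EFinM (ACp_normE p1 fp); exact: le_normc_LpnormE.
Qed.

Lemma ACp_norm_ge0 p f : 0 <= ACp_norm p f.
Proof. by apply: fine_ge0; exact: cLp_ge0. Qed.

(** Common source of the closure under sums, products, conjugation and quotients: an almost
    everywhere bound on the derivative gives membership and the norm estimate at once. *)
Lemma ACp_dom p K1 K2 f g h : (1 <= p)%E -> 0 <= K1 -> 0 <= K2 -> ACp p g -> ACp p h ->
  cAC f -> f (clampI 0) = 0 ->
  {ae leb01, forall x, normc (Dc f x) <= K1 * normc (Dc g x) + K2 * normc (Dc h x)} ->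
  ACp p f /\ ACp_norm p f <= K1 * ACp_norm p g + K2 * ACp_norm p h.
Proof.
move=> p1 K10 K20 gp hp cf f0 dom.
have [cg _ goo] := (ACpP g p1).1 gp; have [ch _ hoo] := (ACpP h p1).1 hp.
have le := cLp_dom p1 K10 K20 (cAC_measurable cf) (cAC_measurable cg) (cAC_measurable ch) dom.
have fp : ACp p f.
  apply/(ACpP f p1); split => //; apply: (le_lt_trans le).
  by rewrite -(ACp_normE p1 gp) -(ACp_normE p1 hp) -!EFinM -EFinD ltry.
split => //; rewrite -lee_fin (ACp_normE p1 fp) EFinD !EFinM.
by rewrite (ACp_normE p1 gp) (ACp_normE p1 hp).
Qed.

Lemma ACp0 p : (1 <= p)%E -> ACp p (0 : Icc01 R -> Cplx R).
Proof.
move=> p1; apply/(ACpP 0 p1); split => //; first exact: (cAC_cst 0).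
rewrite (_ : Dc 0 = fun=> 0); last by apply/funext => x; exact: (Dc_cst 0).
rewrite /LpnormE (_ : (fun _ => _) = cst 0%E) ?Lnorm0//.
  by rewrite gt_eqF// (lt_le_trans _ p1).
by apply/funext => x; rewrite Normc.normc0.
Qed.

Lemma ACp_add p f g : (1 <= p)%E -> ACp p f -> ACp p g ->
  ACp p (f + g) /\ ACp_norm p (f + g) <= ACp_norm p f + ACp_norm p g.
Proof.
move=> p1 fp gp; have [cf f0 _] := (ACpP f p1).1 fp.
have [cg g0 _] := (ACpP g p1).1 gp.
rewrite -[ACp_norm p f]mul1r -[ACp_norm p g]mul1r; apply: ACp_dom => //.
- exact: cAC_add.
- by rewrite !fctE f0 g0 addr0.
- by apply: (ae_imp _ (Dc_add cf cg)) => x ->; rewrite !mul1r; exact: le_normcD.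
Qed.

Lemma ACp_scale p (c : R[i]) f : (1 <= p)%E -> ACp p f ->
  ACp p (c *: f) /\ ACp_norm p (c *: f) = normc c * ACp_norm p f.
Proof.
move=> p1 fp; have [cf f0 foo] := (ACpP f p1).1 fp.
have cc := cAC_cst (c : Cplx R).
have E : c *: f = (fun=> (c : Cplx R)) * f by apply/funext.
have cE : cAC (c *: f) by rewrite E; exact: cAC_mul.
have LE : LpnormE p (Dc (c *: f)) = ((normc c)%:E * LpnormE p (Dc f))%E.
  rewrite -(cLp_scale c p1 (cAC_measurable cf)); apply: cLp_eq => //.
  - exact: cAC_measurable.
  - exact/cmeasurableM/cAC_measurable.
  rewrite E; apply: (ae_imp _ (Dc_mul cc cf)) => x ->.
  by rewrite Dc_cst mul0r add0r.
have fE : ACp p (c *: f).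
  apply/(ACpP _ p1); split => //; first by rewrite E fctE f0 mulr0.
  by rewrite LE -(ACp_normE p1 fp) -EFinM ltry.
split => //; apply: EFin_inj; rewrite (ACp_normE p1 fE) LE EFinM.
by rewrite (ACp_normE p1 fp).
Qed.

Lemma ACp_mul p f g : (1 <= p)%E -> ACp p f -> ACp p g ->
  ACp p (f * g) /\ ACp_norm p (f * g) <= 4 * ACp_norm p f * ACp_norm p g.
Proof.
move=> p1 fp gp; have [cf f0 _] := (ACpP f p1).1 fp.
have [cg g0 _] := (ACpP g p1).1 gp.
have Bf x := le_normc_ACp_norm x p1 fp; have Bg x := le_normc_ACp_norm x p1 gp.
have fg0 : (f * g) (clampI 0) = 0 by rewrite !fctE f0 mul0r.
(* 4 = 2 + 2: the sup bound is used once in each term of the Leibniz rule. *)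
rewrite [leRHS](_ : _ = 2 * ACp_norm p g * ACp_norm p f + 2 * ACp_norm p f * ACp_norm p g); last ring.
apply: ACp_dom => //; try by rewrite mulr_ge0// ACp_norm_ge0.
  exact: cAC_mul.
apply: (ae_imp _ (Dc_mul cf cg)) => x ->; apply: (le_trans (le_normcD _ _)).
by rewrite !Normc.normcM mulrC lerD// ler_wpM2r ?normc_ge0.
Qed.

Lemma ACp_opp p f : (1 <= p)%E -> ACp p f -> ACp p (- f).
Proof. by move=> p1 /(ACp_scale (-1) p1)[]; rewrite scaleN1r. Qed.

Lemma ACp_norm_eq0 p f : (1 <= p)%E -> ACp p f -> ACp_norm p f = 0 -> f = 0.
Proof.
move=> p1 fp N0; apply/funext => x; apply: Normc.eq0_normc; apply/eqP.
by rewrite eq_le normc_ge0 (le_trans (le_normc_ACp_norm x p1 fp))// N0 mulr0.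
Qed.

Lemma ACp_subset p r : (1 <= p)%E -> (p < r)%E -> @ACp R r `<=` ACp p.
Proof.
move=> p1 pr f; have r1 : (1 <= r)%E by rewrite (le_trans p1)// ltW.
move=> /(ACpP f r1)[cf f0 foo]; apply/(ACpP f p1); split => //.
apply: Lnorm_lty_le foo => //; [exact: lebesgue01T|exact: ltW|].
exact: measurable_normc (cAC_measurable cf).
Qed.

End Algebra.

(** * Completeness *)

Section Completeness.
Context {R : realType}.
Local Notation leb := (@lebesgue_measure R).
Local Notation leb01 := (@lebesgue01 R).
Local Notation normc := (@Normc.normc R).
Implicit Types (f g h : Icc01 R -> Cplx R) (F G : R -> R) (p : \bar R).

Lemma ACp_sub p f g : (1 <= p)%E -> ACp p f -> ACp p g -> ACp p (f - g).
Proof. by move=> p1 fp gp; have [] := ACp_add p1 fp (ACp_opp p1 gp). Qed.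

Lemma Dc_sub p f g : (1 <= p)%E -> ACp p f -> ACp p g ->
  {ae leb01, forall x, Dc (f - g) x = Dc f x - Dc g x}.
Proof.
move=> p1 fp gp; have [c1 _ _] := (ACpP _ p1).1 (ACp_sub p1 fp gp).
have [c2 _ _] := (ACpP _ p1).1 gp.
by apply: (ae_imp _ (Dc_add c1 c2)) => x; rewrite subrK => ->; rewrite addrK.
Qed.

Lemma LpnormE_Dc_sub p f g : (1 <= p)%E -> ACp p f -> ACp p g ->
  LpnormE p (fun x => Dc f x - Dc g x) = (ACp_norm p (f - g))%:E.
Proof.
move=> p1 fp gp; have sp := ACp_sub p1 fp gp; rewrite (ACp_normE p1 sp).
have [c1 _ _] := (ACpP _ p1).1 sp.
have [c2 _ _] := (ACpP _ p1).1 fp; have [c3 _ _] := (ACpP _ p1).1 gp.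
apply: cLp_eq => //; first by apply: cmeasurableB; exact: cAC_measurable.
  exact: cAC_measurable.
by apply: (ae_imp _ (Dc_sub p1 fp gp)) => x ->.
Qed.

Lemma half_sum (n : nat) : \sum_(0 <= k < n) (2 ^- k : R) = 2 - 2 * 2 ^- n.
Proof.
elim: n => [|n IH]; first by rewrite big_geq// expr0 invr1; ring.
by rewrite big_nat_recr//= IH exprS invfM; field; rewrite expf_neq0.
Qed.

Lemma nneseries_half : (\sum_(k <oo) (2 ^- k : R)%:E < +oo)%E.
Proof.
apply: (@le_lt_trans _ _ 2%:E); last exact: ltry.
have k0 (k : nat) : (0 <= (2 ^- k : R)%:E)%E by rewrite lee_fin invr_ge0 exprn_ge0.
apply: lime_le; first by apply: is_cvg_nneseries.
apply: nearW => n; rewrite sumEFin lee_fin half_sum lerBlDr lerDl.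
by rewrite mulr_ge0// invr_ge0 exprn_ge0.
Qed.

Lemma cvg_normcB (a1 a2 : nat -> R) (b1 b2 : R) (z : Cplx R) :
  a1 @ \oo --> b1 -> a2 @ \oo --> b2 ->
  normc (z - Complex (a1 n) (a2 n)) @[n --> \oo] --> normc (z - Complex b1 b2).
Proof.
move=> h1 h2; case: z => z1 z2 /=.
apply: (@cvg_comp _ _ _ (fun n => (z1 - a1 n) ^+ 2 + (z2 - a2 n) ^+ 2) Num.sqrt _
  (nbhs ((z1 - b1) ^+ 2 + (z2 - b2) ^+ 2))); last exact: sqrt_continuous.
by apply: cvgD; rewrite expr2; under eq_fun do rewrite expr2;
  apply: cvgM; apply: cvgB => //; exact: cvg_cst.
Qed.

Lemma ACp_complete p : (1 <= p)%E -> is_complete (@ACp R p) (ACp_norm p).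
Proof.
move=> p1 u uA uC.
have /choice[N0 N0P] : forall k : nat, exists n0 : nat, forall m n, (n0 <= m)%N ->
    (n0 <= n)%N -> ACp_norm p (u m - u n) < 2 ^- k.
  by move=> k; apply: uC; rewrite invr_gt0 exprn_gt0.
(* The partial sums make [phi] monotone and at least [N0]; the summand [k] makes it tend to
   infinity. *)
pose phi k := (\sum_(i < k.+1) N0 i + k)%N.
have phiN k : (N0 k <= phi k)%N.
  by rewrite /phi big_ord_recr /= -addnA addnCA leq_addr.
have phiS k : (phi k <= phi k.+1)%N.
  by rewrite /phi [in leqRHS]big_ord_recr /= leq_add// leq_addr.
have phik k : (k <= phi k)%N by exact: leq_addl.
pose v k := u (phi k); have vA k : ACp p (v k) by exact: uA.
have mv k : cmeasurable (Dc (v k)).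
  by have [c _ _] := (ACpP _ p1).1 (vA k); exact: cAC_measurable.
have dv k : (LpnormE 1%E (fun x => Dc (v k.+1) x - Dc (v k) x)%R <= (2 ^- k)%:E)%E.
  apply: le_trans (cLp1_le p1 (cmeasurableB (mv k.+1) (mv k))) _.
  by rewrite LpnormE_Dc_sub// lee_fin ltW// N0P// (leq_trans _ (phiS k)).
have summ (part : R[i] -> R) : (forall a b, part (a - b) = part a - part b) ->
    (forall z, `|part z| <= normc z) ->
    (forall k, measurable_fun setT (fun x => part (Dc (v k) x))) ->
    exists2 g : R -> R, measurable_fun setT g &
      {ae leb01, forall x, part (Dc (v n) x) @[n --> \oo] --> (g x : R)}.
  move=> pB pn mp; apply: (@ae_cvg_of_summable _ _ _ leb01) => //.
  apply: le_lt_trans nneseries_half; apply: lee_nneseries => [k _ _|k _]; first exact: Lnorm_ge0.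
  apply: le_trans (dv k); apply: le_ae_Lnorm => //.
  - by apply: measurable_funB; exact: mp.
  - by apply: measurable_normc; exact: cmeasurableB.
  - by apply: aeW => x; rewrite -pB [leRHS]ger0_norm ?normc_ge0.
have [g1 mg1 cg1] := summ (@complex.Re R) (raddfB _) (@Re_le_normc R) (fun k => (mv k).1).
have [g2 mg2 cg2] := summ (@complex.Im R) (raddfB _) (@Im_le_normc R) (fun k => (mv k).2).
pose g x : Cplx R := Complex (g1 x) (g2 x).
have mg : cmeasurable g by split.
(* Lower semicontinuity lets the second term tend to the limit derivative [g]. Used for the
   finiteness of the seminorm of [g], then for the convergence of the whole sequence. *)
have lsc n (e : R) : (forall k, (n <= k)%N -> ACp_norm p (u n - v k) <= e) ->
    (LpnormE p (fun x => Dc (u n) x - g x)%R <= e%:E)%E.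
  move=> ne; have mu' : cmeasurable (Dc (u n)).
    by have [c _ _] := (ACpP _ p1).1 (uA n); exact: cAC_measurable.
  apply: (@Lnorm_lsc _ _ _ leb01 p
    (fun k x => normc (Dc (u n) x - Dc (v (k + n)%N) x))) => //.
  - by move=> k; apply: measurable_normc; exact: cmeasurableB.
  - by apply: measurable_normc; exact: cmeasurableB.
  - apply: (ae_imp2 _ cg1 cg2) => x h1 h2.
    have := @cvg_normcB _ _ _ _ (Dc (u n) x) h1 h2.
    rewrite -(cvg_shiftn n) => h; apply: cvg_trans h; apply: near_eq_cvg.
    by apply: nearW => k /=; case: (Dc (v _) x).
  - move=> k; have := LpnormE_Dc_sub p1 (uA n) (vA (k + n)%N).
    rewrite /LpnormE => ->; rewrite lee_fin ne//; exact: leq_addl.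
have goo : (LpnormE p g < +oo)%E.
  have [c _ voo] := (ACpP _ p1).1 (vA 0%N).
  have d0 : (LpnormE p (fun x => Dc (v 0%N) x - g x)%R <= 1%:E)%E.
    apply: lsc => k _; apply: ltW; have := N0P 0%N (phi 0%N) (phi k).
    rewrite expr0 invr1; apply; first exact: phiN.
    elim: k => [|k IH]; first exact: phiN.
    exact: leq_trans IH (phiS k).
  have := @cLp_dom _ p 1 1 g (Dc (v 0%N)) (fun x => Dc (v 0%N) x - g x)%R p1 ler01 ler01 mg (mv 0%N).
  move=> /(_ (cmeasurableB (mv 0%N) mg)) H; apply: le_lt_trans (H _) _.
    apply: aeW => x; rewrite !mul1r.
    rewrite -[normc (_ - _)]normcN -[X in normc X <= _](subrK (Dc (v 0%N) x)) addrC opprB.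
    by rewrite [X in normc X](_ : _ = Dc (v 0%N) x + (g x - Dc (v 0%N) x)); [exact: le_normcD|ring].
  by rewrite !mul1e lte_add_pinfty// (le_lt_trans d0)// ltry.
have mgE : measurable_fun setT (fun x => (normc (g x))%:E).
  by apply/measurable_EFinP; exact: measurable_normc.
have goo1 := le_lt_trans (cLp1_le p1 mg) goo.
(* Cutting off outside []0, 1]] makes the parts of [g] integrable on the line and their primitives
   zero at 0. *)
pose G (k : R -> R) := k \_ (`]0, 1]%classic : set R).
have iG (k : R -> R) : measurable_fun setT k -> (forall x, `|k x| <= normc (g x)) ->
    leb.-integrable setT (EFin \o G k).
  move=> mk kg; have mI : measurable (`]0, 1]%classic : set (measurableTypeR R)).
    exact: (@measurable_itv R).
  rewrite (_ : EFin \o G k = (EFin \o k) \_ (`]0, 1]%classic : set R)); last first.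
    by rewrite /G restrict_EFin.
  apply/(integrable_mkcond _ mI); apply/integrableP; split.
    by apply: measurable_funTS; exact/measurable_EFinP.
  apply: le_lt_trans goo1; rewrite /LpnormE Lnorm1.
  under [leRHS]eq_integral do rewrite gee0_abs ?lee_fin ?normc_ge0//.
  rewrite integral_lebesgue01; last 2 first.
  - exact: mgE.
  - by move=> t; rewrite lee_fin normc_ge0.
  apply: (@le_trans _ _ (\int[leb]_(x in `]0%R, 1%R]) (normc (g x))%:E)%E).
    apply: ge0_le_integral => //.
    - by apply: measurable_funTS; apply: measurableT_comp => //; exact/measurable_EFinP.
    - by apply: measurable_funTS; exact: mgE.
    - by move=> x _; rewrite /= lee_fin.
  apply: ge0_subset_integral => //.
  - exact: (@measurable_itv R).
  - by apply: measurable_funTS; exact: mgE.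
  - by move=> t _; rewrite lee_fin normc_ge0.
  - by move=> t; rewrite /Icc01 /= !in_itv/= => /andP[/ltW -> ->].
have iG1 := iG g1 mg1 (fun x => Re_le_normc (g x)).
have iG2 := iG g2 mg2 (fun x => Im_le_normc (g x)).
have G0 k : primitive (G k) 0 = 0.
  rewrite /primitive /Rintegral integral0_eq// => x /=.
  by rewrite in_itv/= /G => x0; rewrite patchE memNset//= in_itv/= ltNge x0.
pose l (x : Icc01 R) : Cplx R := Complex (primitive (G g1) (\val x)) (primitive (G g2) (\val x)).
have cl : cAC l by split; exact: primitive_clamp_AC.
have Dl : {ae leb01, forall x, Dc l x = g x}.
  apply: ae_lebesgue01.
  apply: (ae_imp2 _ (primitive_clamp_derive1 iG1) (primitive_clamp_derive1 iG2)).
  move=> x h1 h2 x01; have xin : x \in (`]0, 1]%classic : set R).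
    by move/andP: x01 => [x0 /ltW x1]; rewrite inE /= in_itv/= x0.
  rewrite /Dc /g; congr Complex; [rewrite [LHS](h1 x01)|rewrite [LHS](h2 x01)];
    by rewrite /G patchE xin.
have lA : ACp p l.
  apply/(ACpP l p1); split => //.
    by rewrite /l /= clamp_id ?lexx ?ler01// !G0.
  by rewrite (cLp_eq p1 (cAC_measurable cl) mg Dl).
exists l => //; apply/cvgrPdist_lt => e e0.
have e20 : 0 < e / 2 by rewrite divr_gt0.
have [n0 n0P] := uC _ e20.
near=> n; rewrite sub0r normrN ger0_norm ?ACp_norm_ge0//.
have n0n : (n0 <= n)%N by near: n; exists n0.
apply: (@le_lt_trans _ _ (e / 2)); last by rewrite ltr_pdivrMr// ltr_pMr// ltr1n.
rewrite -lee_fin -LpnormE_Dc_sub//.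
have [cu _ _] := (ACpP _ p1).1 (uA n).
have mu' := cAC_measurable cu.
rewrite (@cLp_eq _ p _ (fun x => Dc (u n) x - g x)) //.
- apply: lsc => k nk; apply/ltW/n0P => //.
  by rewrite (leq_trans n0n)// (leq_trans nk).
- by apply: cmeasurableB => //; exact: cAC_measurable.
- exact: cmeasurableB.
- by apply: (ae_imp _ Dl) => x ->.
Unshelve. all: by end_near. Qed.

End Completeness.

(** * Continuity, the Banach algebra structure, and the case p = oo *)

Section Continuity.
Context {R : realType}.
Local Notation leb := (@lebesgue_measure R).
Local Notation leb01 := (@lebesgue01 R).
Local Notation normc := (@Normc.normc R).
Implicit Types (f g h : Icc01 R -> Cplx R) (F G : R -> R) (p : \bar R).

(** In the partial order of [R[i]], [0 < e] forces [e] to be real, so its real part decides. *)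
Lemma normc_lt (z e : R[i]) : 0 < e -> normc z < complex.Re e -> `|z : Cplx R| < e.
Proof.
case: e => a b; rewrite ltcE /= => /andP[/eqP b0 a0] za.
by rewrite -[`|_|]/((normc z)%:C%C) ltcE /= b0 eqxx.
Qed.

Lemma continuous_Complex (T : topologicalType) (u v : T -> R) :
  continuous u -> continuous v -> continuous (fun t => Complex (u t) (v t) : Cplx R).
Proof.
move=> cu cv x; apply/cvgrPdist_lt => e e0.
have e1 : 0 < complex.Re e / 2.
  by move: e0; case: e => a b; rewrite ltcE /= => /andP[_ a0]; rewrite divr_gt0.
have /cvgrPdist_lt/(_ _ e1) h1 := cu x; have /cvgrPdist_lt/(_ _ e1) h2 := cv x.
near=> t; apply: normc_lt => //; apply: (le_lt_trans (normc_le_ReIm _)) => /=.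
by rewrite [ltRHS]splitr ltrD//; near: t.
Unshelve. all: by end_near. Qed.

Lemma continuous_Re : continuous (fun z : Cplx R => complex.Re z : R).
Proof.
move=> z; apply/(@cvgrPdist_lt _ _ _ (nbhs (z : Cplx R)) _) => e e0.
have e1 : 0 < e%:C%C by rewrite ltcR.
have /cvgrPdist_lt/(_ _ e1) := @cvg_id _ (nbhs z); apply: filterS => w.
rewrite -[`|_|]/((normc (z - w))%:C%C) ltcR => zw.
by rewrite -raddfB; exact: le_lt_trans (Re_le_normc _) zw.
Qed.

Lemma continuous_set_val : continuous (\val : Icc01 R -> R).
Proof. exact: (@initial_continuous (Icc01 R) R set_val). Qed.

Lemma cAC_continuous f : cAC f -> continuous f.
Proof.
move=> [aR aI]; have -> : f = fun x => Complex (reF f (\val x)) (imF f (\val x)).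
  by apply/funext => x; rewrite /reF /imF clampI_val; case: (f x).
apply: continuous_Complex => x;
  by apply: (continuous_comp (@continuous_set_val x)); exact: AC_continuous.
Qed.

Lemma ACp_banach_subalgebra p : (1 <= p)%E ->
  is_banach_subalgebra (@ACp R p) (continuous_functions (Icc01 R)) (ACp_norm p).
Proof.
move=> p1; split.
- split.
  + by move=> f /(ACpP f p1)[cf _ _]; exact: cAC_continuous.
  + exact: ACp0.
  + by move=> f g fp gp; have [] := ACp_add p1 fp gp.
  + by move=> c f fp; have [] := ACp_scale c p1 fp.
  + by move=> f g fp gp; have [] := ACp_mul p1 fp gp.
- split.
  + by move=> f _; exact: ACp_norm_ge0.
  + by move=> f fp; exact: ACp_norm_eq0.
  + by move=> c f fp; have [] := ACp_scale c p1 fp.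
  + by move=> f g fp gp; have [] := ACp_add p1 fp gp.
- exact: ACp_complete.
- by exists 4 => f g fp gp; have [] := ACp_mul p1 fp gp.
Qed.

Lemma ACp_bounded p f (M : R) : (1 <= p)%E -> cAC f -> f (clampI 0) = 0 ->
  {ae leb01, forall x, normc (Dc f x) <= M} -> ACp p f.
Proof.
move=> p1 cf f0 fM; apply/(ACpP f p1); split => //.
apply: (@Lnorm_lty_le _ _ _ leb01 p +oo%E) => //.
- exact: lebesgue01T.
- exact: leey.
- exact: measurable_normc (cAC_measurable cf).
rewrite unlock /Lnorm lebesgue01T lte01; apply: (@le_lt_trans _ _ M%:E); last exact: ltry.
apply/ess_supP; apply: (ae_imp _ fM) => x; rewrite /= lee_fin ger0_norm ?normc_ge0//.
Qed.

(** The coordinate function: test element against approximate identities for p = oo, and the element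
    from which a character's point is read off. *)
Definition inclusion01 (x : Icc01 R) : Cplx R := (\val x)%:C%C.

Lemma inclusion01_ACp p : (1 <= p)%E -> ACp p inclusion01.
Proof.
move=> p1; have cI : cAC inclusion01.
  split; last by apply: (AC_lip (K := 0)) => x y; rewrite /imF /= subrr normr0 mul0r.
  apply: (AC_clamp (F := id)); apply: (AC_lip (K := 1)) => x y; rewrite mul1r//.
apply: (@ACp_bounded _ _ 1) => //.
  by rewrite /inclusion01 /= clamp_id ?lexx ?ler01.
apply: ae_lebesgue01; apply: aeW => x x01.
have -> : Dc inclusion01 x = 1.
  rewrite /Dc; congr Complex; last by rewrite /imF derive1_cst.
  rewrite (near_eq_derive1 (G := id)) ?derive1_id//.
  by apply: filterS (near_itv01 x01) => y y01; rewrite /reF /= clamp_id.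
by rewrite Normc.normc1.
Qed.

Lemma le_normc_ACp_normy f (x : Icc01 R) : ACp +oo%E f ->
  normc (f x) <= 2 * (\val x * ACp_norm +oo%E f).
Proof.
move=> fp; have y1 : (1 <= +oo :> \bar R)%E by exact: leey.
have [cf f0 foo] := (ACpP f y1).1 fp; have /andP[x0 x1] := Icc01_itv x.
rewrite -lee_fin EFinM; apply: (le_trans (le_normc_integral x cf f0)).
apply: lee_wpmul2l => //.
have Dy : {ae leb01, forall t, normc (Dc f t) <= ACp_norm +oo%E f}.
  have := ess_sup_ge leb01 (abse \o (EFin \o (fun t => normc (Dc f t)))).
  have := ACp_normE y1 fp; rewrite /LpnormE unlock /Lnorm lebesgue01T lte01 => <-.
  by apply: filterS => t; rewrite /= lee_fin ger0_norm ?normc_ge0.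
have mx : measurable (`]0, (\val x)]%classic : set (measurableTypeR R)).
  exact: (@measurable_itv R).
apply: (@le_trans _ _ (\int[leb]_(t in `]0%R, (\val x)]) (ACp_norm +oo%E f)%:E)%E).
  apply: ae_ge0_le_integral => //.
  - by move=> t _; rewrite lee_fin normc_ge0.
  - by apply: measurable_funTS; exact: measurable_Dc.
  - by move=> t _; rewrite lee_fin ACp_norm_ge0.
  - apply: (ae_imp _ (ae_lebesgue01_lebesgue Dy)) => t Dt /=.
    rewrite in_itv/= => /andP[t0 tx]; rewrite lee_fin; apply: Dt.
    by rewrite ltW//= (le_trans tx).
have lx : leb `]0, (\val x)]%classic = (\val x)%:E.
  rewrite lebesgue_measure_itv /= lte_fin; case: ltgtP x0 => // [x0 _|<-//].
  by rewrite -EFinB subr0.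
by rewrite integral_cst// [X in (_ * X)%E]lx -EFinM mulrC.
Qed.

Lemma ACpy_no_approximate_identity :
  ~ has_approximate_identity (@ACp R +oo%E) (ACp_norm +oo%E).
Proof.
have y1 : (1 <= +oo :> \bar R)%E by exact: leey.
move=> [D [le [e [[_ lerefl _ _] eA eP]]]].
have iA := inclusion01_ACp y1.
(* A norm below 1/4 gives |f(t) - 1| < 1/2 for t > 0, while near 0 continuity gives |f(t)| < 1/4,
   with 1/8 for each of the real and imaginary parts. The two add up to less than 1. *)
have e40 : 0 < 4^-1 :> R by rewrite invr_gt0.
have [a0 /(_ a0 (lerefl _))] := eP _ iA _ e40.
have fA := eA a0; set f := e a0 in fA * => Nf.
have hA : ACp +oo%E (f * inclusion01 - inclusion01).
  by apply: ACp_sub => //; have [] := ACp_mul y1 fA iA.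
have [[aR aI] f0 _] := (ACpP f y1).1 fA.
have e80 : 0 < 8^-1 :> R by rewrite invr_gt0.
have [d1 d10 d1P] := AC_pair aR e80; have [d2 d20 d2P] := AC_pair aI e80.
pose t := Num.min 1 (Num.min d1 d2 / 2).
have d0 : 0 < Num.min d1 d2 by rewrite lt_min d10.
have t0 : 0 < t by rewrite /t lt_min ltr01 divr_gt0.
have t1 : t <= 1 by rewrite /t ge_min lexx.
have td : t < Num.min d1 d2.
  by rewrite /t gt_min; apply/orP; right; rewrite ltr_pdivrMr// ltr_pMr// ltr1n.
have vt : \val (clampI t) = t by rewrite /= clamp_id// t1 ltW.
have ft : normc (f (clampI t)) < 4^-1.
  apply: (le_lt_trans (normc_le_ReIm _)).
  move: td; rewrite lt_min => /andP[td1 td2].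
  have := d1P 0 t; have := d2P 0 t; rewrite !subr0 !(gtr0_norm t0) => /(_ td2) h2 /(_ td1) h1.
  rewrite /reF f0 subr0 in h1; rewrite /imF f0 subr0 in h2; lra.
have := le_normc_ACp_normy (clampI t) hA.
have -> : (f * inclusion01 - inclusion01) (clampI t) = t%:C%C * (f (clampI t) - 1).
  transitivity (f (clampI t) * inclusion01 (clampI t) - inclusion01 (clampI t)) => //.
  by rewrite /inclusion01 vt mulrBr mulr1 mulrC.
rewrite vt Normc.normcM.
have -> : normc t%:C%C = t by rewrite normcE /= expr0n addr0 sqrtr_sqr gtr0_norm.
have : 1 <= normc (f (clampI t)) + normc (f (clampI t) - 1).
  rewrite -(@Normc.normc1 R) -[normc (f _ - 1)]normcN opprB.
  by rewrite [X in normc X](_ : _ = f (clampI t) + (1 - f (clampI t))); [exact: le_normcD|ring].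
move: ft Nf; set n1 := normc (f _); set n2 := normc _; set N := ACp_norm _ _ => ft NN n12.
rewrite mulrCA ler_pM2l//; lra.
Qed.

End Continuity.

(** * Approximate identities for finite p *)

Section ApproximateIdentity.
Context {R : realType}.
Local Notation leb := (@lebesgue_measure R).
Local Notation leb01 := (@lebesgue01 R).
Local Notation normc := (@Normc.normc R).
Implicit Types (f g h : Icc01 R -> Cplx R) (n : nat) (p : \bar R).

(** Slope [n + 1], so that the breakpoint 1/(n+1) lies in []0, 1]] for every [n]. *)
Definition cutoff n (x : Icc01 R) : Cplx R := (Num.min (n.+1%:R * \val x) 1)%:C%C.

Lemma cutoff_cAC n : cAC (cutoff n).
Proof.
split; last by apply: (AC_lip (K := 0)) => x y; rewrite /imF /= subrr normr0 mul0r.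
apply: (AC_clamp (F := fun t => Num.min (n.+1%:R * t) 1)).
apply: (AC_lip (K := n.+1%:R)) => x y.
have n0 : 0 < n.+1%:R :> R by [].
have H (a b : R) : `|Num.min b 1 - Num.min a 1| <= `|b - a|.
  by rewrite /Num.min; do 2 case: ifPn; rewrite -?leNgt => h1 h2; rewrite ler_norml;
    have := ler_norm (b - a); have := ler_norm (a - b); rewrite (distrC a); lra.
by rewrite (le_trans (H _ _))// -mulrBr normrM gtr0_norm.
Qed.

Lemma cutoff0 n : cutoff n (clampI 0) = 0.
Proof. by rewrite /cutoff /= clamp_id ?lexx ?ler01// mulr0 min_l. Qed.

Lemma Dc_cutoff_lt n x : 0 < x < n.+1%:R^-1 -> Dc (cutoff n) x = n.+1%:R%:C%C.
Proof.
move=> /andP[x0 xn]; rewrite /Dc; congr Complex; last by rewrite /imF derive1_cst.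
rewrite (near_eq_derive1 (G := fun t => n.+1%:R * t)).
  by rewrite derive1E (_ : (fun t => _) = n.+1%:R *: id)// deriveZ// derive_id /GRing.scale /= mulr1.
have : x \in `]0, n.+1%:R^-1[%R by rewrite in_itv/= x0.
move=> /near_in_itvoo; apply: filterS => t; rewrite in_itv/= => /andP[t0 tn].
have t1 : t < 1 by rewrite (lt_le_trans tn)// invf_le1// ler1n.
rewrite /reF /cutoff /= clamp_id ?ltW// min_l//.
by rewrite -ler_pdivlMl// mulr1 ltW.
Qed.

Lemma Dc_cutoff_gt n x : n.+1%:R^-1 < x < 1 -> Dc (cutoff n) x = 0.
Proof.
move=> /andP[xn x1]; rewrite /Dc -[RHS]/(Complex 0 0); congr Complex; last by rewrite /imF derive1_cst.
rewrite (near_eq_derive1 (G := cst 1)) ?derive1_cst//.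
have : x \in `]n.+1%:R^-1, 1[%R by rewrite in_itv/= xn.
move=> /near_in_itvoo; apply: filterS => t; rewrite in_itv/= => /andP[tn t1].
have t0 : 0 < t by rewrite (lt_trans _ tn).
by rewrite /reF /cutoff /= clamp_id ?ltW// min_r// -ler_pdivrMl// mulr1 ltW.
Qed.

Lemma ae_neq (c : R) : {ae leb, forall x : R, x != c}.
Proof.
exists [set c]; split; [exact: (@measurable_set1 R)|exact: lebesgue_measure_set1|].
by move=> x /= /negP; rewrite negbK => /eqP.
Qed.

Lemma cutoff_ACp p n : (1 <= p)%E -> ACp p (cutoff n).
Proof.
move=> p1; apply: (@ACp_bounded _ _ _ n.+1%:R) => //; [exact: cutoff_cAC|exact: cutoff0|].
apply: ae_lebesgue01; apply: (ae_imp _ (ae_neq n.+1%:R^-1)) => x + /andP[x0 x1].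
rewrite neq_lt => /orP[xn|xn].
  rewrite Dc_cutoff_lt ?x0// normcE /= expr0n addr0 sqrtr_sqr ger0_norm//.
by rewrite Dc_cutoff_gt ?xn// Normc.normc0.
Qed.

Lemma Lnorm_indic (s c : R) : 0 < s -> 0 < c <= 1 ->
  'N[leb01]_s%:E[EFin \o (\1_(`]0%R, c]%classic) : R -> R)]%E = (c `^ s^-1)%:E.
Proof.
move=> s0 /andP[c0 c1]; rewrite unlock /Lnorm.
have mc : measurable (`]0, c]%classic : set (measurableTypeR R)) by exact: (@measurable_itv R).
rewrite (_ : (\int[leb01]_x _)%E = c%:E) ?poweR_EFin//.
under eq_integral => x _.
  rewrite (_ : _ `^ s = (\1_(`]0, c]%classic : set (measurableTypeR R)) x)%:E)%E; last first.
    rewrite /= indicE; case: (x \in _) => /=; first by rewrite normr1 powR1.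
    by rewrite normr0 powR0// gt_eqF.
  over.
rewrite integral_indic// setIT /lebesgue01 /= /mrestr (_ : _ `&` _ = `]0, c]%classic).
  by rewrite lebesgue_measure_itv /= lte_fin c0 -EFinB subr0.
apply/setIidPl => t /=; rewrite !in_itv/= => /andP[/ltW -> tc] /=.
exact: le_trans tc c1.
Qed.

Section Estimate.
Variables (r : R) (f : Icc01 R -> Cplx R) (n : nat).
Hypotheses (r1 : 1 <= r) (fp : ACp r%:E f).

Let c : R := n.+1%:R^-1.
Let A : set R := `]0, c]%classic.
(** The part of |f'| near 0; its L^r norm controls the whole error. *)
Let w : R -> R := fun t => normc (Dc f t) * \1_A t.

Let p1 : (1 <= r%:E)%E. Proof. by rewrite lee_fin. Qed.
Let r0 : 0 < r. Proof. exact: lt_le_trans r1. Qed.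
Let c01 : 0 < c <= 1.
Proof. by rewrite /c invr_gt0 ltr0n /= invf_le1// ler1n. Qed.
Let cf : cAC f. Proof. by have [] := (ACpP f p1).1 fp. Qed.
Let f0 : f (clampI 0) = 0. Proof. by have [] := (ACpP f p1).1 fp. Qed.
Let mA : measurable (A : set (measurableTypeR R)). Proof. exact: (@measurable_itv R). Qed.
Let m1A : measurable_fun setT (\1_A : R -> R). Proof. exact: measurable_indic. Qed.
Let mw : measurable_fun setT w.
Proof.
apply: measurable_funM => //; exact: measurable_normc (cAC_measurable cf).
Qed.
Let w0 t : 0 <= w t. Proof. by rewrite mulr_ge0 ?normc_ge0// indicE. Qed.

Let Nw1_le : ('N[leb01]_1[EFin \o w] <= 'N[leb01]_r%:E[EFin \o w])%E.
Proof. by apply: Lnorm1_le => //; exact: lebesgue01T. Qed.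

Lemma LpnormE_cutoff_lty : ('N[leb01]_r%:E[EFin \o w] < +oo)%E.
Proof.
have [_ _ foo] := (ACpP f p1).1 fp; apply: le_lt_trans foo.
apply: le_ae_Lnorm => //; first exact: measurable_normc (cAC_measurable cf).
apply: aeW => t; rewrite ger0_norm// [leRHS]ger0_norm ?normc_ge0// /w indicE.
by rewrite -[leRHS]mulr1 ler_wpM2l ?normc_ge0// lern1 leq_b1.
Qed.

Let s : R := fine ('N[leb01]_1[EFin \o w])%E.
Let sE : s%:E = ('N[leb01]_1[EFin \o w])%E.
Proof.
rewrite /s fineK// ge0_fin_numE ?Lnorm_ge0//.
exact: le_lt_trans Nw1_le LpnormE_cutoff_lty.
Qed.

Let f_le (x : Icc01 R) : \val x <= c -> normc (f x) <= 2 * s.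
Proof.
move=> xc; rewrite -lee_fin EFinM sE; apply: (le_trans (le_normc_integral x cf f0)).
have mx : measurable (`]0, (\val x)]%classic : set (measurableTypeR R)).
  exact: (@measurable_itv R).
apply: lee_wpmul2l => //; rewrite Lnorm1.
under [leRHS]eq_integral do rewrite gee0_abs ?lee_fin//.
rewrite integral_lebesgue01; last 2 first.
- exact/measurable_EFinP.
- by move=> t; rewrite lee_fin.
apply: (@le_trans _ _ (\int[leb]_(t in `]0%R, (\val x)]) (w t)%:E)%E).
  rewrite le_eqVlt; apply/orP; left; apply/eqP; apply: eq_integral => t.
  rewrite inE/= in_itv/= => /andP[t0 tx]; rewrite /w indicE mem_set ?mulr1//.
  by rewrite /A /= in_itv/= t0 (le_trans tx).
apply: ge0_subset_integral => //.
- exact: (@measurable_itv R).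
- by apply: measurable_funTS; exact/measurable_EFinP.
- by move=> t _; rewrite lee_fin.
- move=> t; rewrite /Icc01 /= !in_itv/= => /andP[/ltW -> tx] /=.
  by apply: (le_trans tx); case/andP: (Icc01_itv x).
Qed.

(** Hoelder bounds [s] by the L^r norm of [w] times c^(1 - 1/r), and the indicator has norm c^(1/r):
    the powers of c combine to c, which cancels the slope 1/c. *)
Let hoelder_step : ((n.+1%:R * s)%:E * 'N[leb01]_r%:E[EFin \o (\1_A : R -> R)] <=
  'N[leb01]_r%:E[EFin \o w])%E.
Proof.
have c0 : 0 < c by case/andP: c01.
have nc : n.+1%:R * c = 1 by rewrite mulfV.
rewrite /A Lnorm_indic// EFinM sE.
(* For [r = 1] the conjugate exponent is infinite, whereas the real number [(1 - r^-1)^-1] would be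
   0. *)
have [->|r_neq1] := eqVneq r 1.
  by rewrite invr1 (powRr1 (ltW c0)) muleAC -EFinM nc mul1e.
have rgt1 : 1 < r by rewrite lt_neqAle eq_sym r_neq1.
have q0 : 0 < (1 - r^-1)^-1 by rewrite invr_gt0 subr_gt0 invf_lt1.
have := @hoelder _ _ _ leb01 w \1_A r (1 - r^-1)^-1 mw m1A r0 q0.
rewrite invrK subrKC => /(_ erefl); rewrite /A Lnorm_indic// invrK.
rewrite (_ : (w \* _)%R = w); last first.
  by apply/funext => t; rewrite /w /= -mulrA -/A !indicE; case: (t \in A); rewrite ?mulr1 ?mulr0.
move=> H; apply: (@le_trans _ _ (n.+1%:R%:E *
    ('N[leb01]_r%:E[EFin \o w] * (c `^ (1 - r^-1))%:E) * (c `^ r^-1)%:E)%E).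
  by apply: lee_wpmul2r; [rewrite lee_fin powR_ge0|apply: lee_wpmul2l].
rewrite -!muleA -EFinM -powRD; last by rewrite subrK oner_eq0.
by rewrite subrK (powRr1 (ltW c0)) muleCA -EFinM nc mule1.
Qed.

(** With e the cutoff, the derivative is e' f + (e - 1) f', which vanishes beyond c. Before c the
    first term is at most [K], contributing 2 through [hoelder_step], and the second at most [w],
    contributing 1. *)
Lemma cutoff_estimate : ((ACp_norm r%:E (cutoff n * f - f))%:E <=
  3%:E * 'N[leb01]_r%:E[EFin \o w])%E.
Proof.
have cp : ACp r%:E (cutoff n * f) by have [] := ACp_mul p1 (cutoff_ACp n p1) fp.
have mD := ACp_sub p1 cp fp; have [cD _ _] := (ACpP _ p1).1 mD.
rewrite (ACp_normE p1 mD).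
have s0 : 0 <= s by apply: fine_ge0; exact: Lnorm_ge0.
pose K := 2 * (n.+1%:R * s).
have K0 : 0 <= K by rewrite !mulr_ge0.
apply: (@le_trans _ _ ('N[leb01]_r%:E[EFin \o ((fun t => K * \1_A t) \+ w)%R])%E).
  have mK : measurable_fun setT (fun t => K * (\1_A : R -> R) t) by exact: measurable_funM.
  apply: le_ae_Lnorm => //.
  - exact: measurable_normc (cAC_measurable cD).
  - exact: measurable_funD.
  have Dm := Dc_mul (cutoff_cAC n) cf; have Ds := Dc_sub p1 cp fp.
  apply: (ae_imp2 _ (ae_imp2 (fun x a b => conj a b) Dm Ds)
    (ae_lebesgue01 (ae_imp2 (fun x a _ b => conj a b) (ae_neq c) (ae_neq c)))).
  move=> x [Dm' ->] [xc /andP[x0 x1]]; rewrite Dm' {Dm'}.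
  rewrite ger0_norm ?normc_ge0// ger0_norm ?addr_ge0 ?mulr_ge0//= ?indicE//.
  move: xc; rewrite neq_lt => /orP[xc|xc]; last first.
    rewrite Dc_cutoff_gt ?xc// mul0r add0r.
    have -> : cutoff n (clampI x) = 1.
      by rewrite /cutoff /= clamp_id ?ltW// min_r// -ler_pdivrMl// mulr1 ltW.
    by rewrite mul1r subrr Normc.normc0 addr_ge0// mulr_ge0.
  rewrite Dc_cutoff_lt ?x0// /w indicE mem_set; last by rewrite /A /= in_itv/= x0 ltW.
  rewrite !mulr1 -addrA.
  apply: (le_trans (le_normcD _ _)); rewrite lerD//.
    rewrite Normc.normcM normcE /= expr0n addr0 sqrtr_sqr ger0_norm// /K mulrCA ler_wpM2l//.
    by apply: f_le; rewrite /= clamp_id ?ltW.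
  rewrite -[X in _ - X]mul1r -mulrBl Normc.normcM -[leRHS]mul1r ler_wpM2r ?normc_ge0//.
  have x01 : 0 <= x <= 1 by rewrite !ltW.
  rewrite /cutoff /= (clamp_id x01) min_l; last by rewrite -ler_pdivlMl// mulr1 ltW.
  have nx0 : 0 <= n.+1%:R * x by rewrite mulr_ge0// ltW.
  have nx1 : n.+1%:R * x <= 1 by rewrite -ler_pdivlMl// mulr1 ltW.
  by rewrite subrr expr0n addr0 sqrtr_sqr ler_norml; lra.
have mK : measurable_fun setT (fun t => K * (\1_A : R -> R) t) by exact: measurable_funM.
apply: (le_trans (@eminkowski _ _ _ leb01 _ _ r%:E mK mw p1)).
rewrite (@Lnorm_scale _ _ _ leb01 r%:E \1_A K)// ger0_norm// /K EFinM -muleA.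
rewrite [leRHS](_ : _ = 2%:E * 'N[leb01]_r%:E[EFin \o w] + 'N[leb01]_r%:E[EFin \o w])%E; last first.
  rewrite -[X in (_ = _ + X)%E]mul1e -ge0_muleDl ?lee_fin// -EFinD.
  by congr (_%:E * _)%E; ring.
apply: leeD => //.
by apply: lee_wpmul2l => //; exact: hoelder_step.
Qed.

(** The last hypothesis is absolute continuity of the integral of |f'|^r; it is applied to [A],
    whose measure is c. *)
Lemma cutoff_tail_lt (e d : R) : 0 < e -> c < d ->
  (forall B : set (measurableTypeR R), measurable B -> (leb01 B < d%:E)%E ->
    (\int[leb01]_(x in B) `|normc (Dc f x) `^ r| < e `^ r)%R) ->
  ('N[leb01]_r%:E[EFin \o w] < e%:E)%E.
Proof.
move=> e0 cd Bd.
have wE t : (`|(EFin \o w) t| `^ r)%E =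
    (((fun t => `|normc (Dc f t) `^ r|%:E)%E) \_ A) t.
  rewrite patchE /w /= indicE; case: (t \in A) => /=.
    by rewrite mulr1 !ger0_norm ?powR_ge0 ?normc_ge0.
  by rewrite mulr0 normr0 powR0// gt_eqF.
have := LpnormE_cutoff_lty; rewrite unlock /Lnorm.
under eq_integral do rewrite wE; rewrite -integral_mkcond.
set J := (\int[leb01]_(_ in _) _)%E => Joo.
have J0 : (0 <= J)%E by apply: integral_ge0.
have Jfin : J \is a fin_num.
  by rewrite ge0_fin_numE//; apply: lty_poweRy Joo; rewrite invr_eq0 gt_eqF.
have AE : (leb01 A < d%:E)%E.
  apply: (@le_lt_trans _ _ c%:E); last by rewrite lte_fin.
  apply: (@le_trans _ _ (leb A)).
    apply: le_measure; rewrite ?inE//.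
    by apply: measurableI => //; exact: (@measurable_itv R).
  by rewrite /A lebesgue_measure_itv /= lte_fin; case/andP: c01 => -> _; rewrite -EFinB subr0.
have := Bd A mA AE; rewrite /Rintegral -/J => Je.
rewrite -(fineK Jfin) poweR_EFin lte_fin.
have -> : e = (e `^ r) `^ r^-1 by rewrite -powRrM mulfV ?gt_eqF// powRr1 ?ltW.
by rewrite gt0_ltr_powR ?invr_gt0// nnegrE ?powR_ge0 ?fine_ge0.
Qed.

End Estimate.

Lemma ACp_approximate_identity p : (1 <= p)%E -> (p < +oo)%E ->
  has_approximate_identity (@ACp R p) (ACp_norm p).
Proof.
case: p => [r| |//] // p1 _; have r1 : 1 <= r by rewrite -lee_fin.
exists nat, (fun m n => (m <= n)%N), cutoff; split.
- split; [exact: (inhabits 0%N)|exact: leqnn|by move=> a b c ab; exact: leq_trans|].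
  by move=> a b; exists (maxn a b); rewrite leq_maxl leq_maxr.
- by move=> n; exact: cutoff_ACp.
move=> f fp e e0.
have [cf _ foo] := (ACpP f p1).1 fp.
have mf := measurable_normc (cAC_measurable cf).
(* The factor 3 of [cutoff_estimate] leaves 3e/4 < e. *)
have e40 : 0 < e / 4 by rewrite divr_gt0.
have ip : leb01.-integrable setT (EFin \o (fun t => normc (Dc f t) `^ r)).
  apply/integrableP; split.
    by apply/measurable_EFinP; exact: (measurableT_comp (measurable_powR r) mf).
  move: foo; rewrite /LpnormE unlock /Lnorm => /lty_poweRy.
  rewrite invr_eq0 gt_eqF ?(lt_le_trans ltr01)// => /(_ isT).
  apply: le_lt_trans; rewrite le_eqVlt; apply/orP; left; apply/eqP.
  by apply: eq_integral => t _; rewrite /= !ger0_norm ?powR_ge0 ?normc_ge0.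
have er0 : 0 < (e / 4) `^ r by rewrite powR_gt0.
have [d [d0 dP]] := integral_normr_continuous ip er0.
have [N _ NP] := near_infty_natSinv_lt (PosNum d0).
exists N => n Nn; rewrite -lte_fin; apply: (le_lt_trans (cutoff_estimate n r1 fp)).
apply: (@le_lt_trans _ _ (3 * (e / 4))%:E); last by rewrite lte_fin; lra.
rewrite EFinM; apply: lee_wpmul2l => //; apply/ltW.
exact: (cutoff_tail_lt r1 fp e40 (NP _ Nn) dP).
Qed.

End ApproximateIdentity.

(** * The maximal ideal space *)

Section Characters.
Context {R : realType}.
Local Notation normc := (@Normc.normc R).
Implicit Types (f g h : Icc01 R -> Cplx R) (p : \bar R).

Definition conjf f : Icc01 R -> Cplx R := fun x => ((f x)^*)%C.

Lemma reF_conj f : reF (conjf f) = reF f.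
Proof. by apply/funext => t; rewrite /reF /conjf; case: (f _). Qed.

Lemma imF_conj f : imF (conjf f) = (fun t => -1 * imF f t).
Proof. by apply/funext => t; rewrite /imF /conjf mulN1r; case: (f _). Qed.

(** Brings |f - m|^2, up to a constant, into the algebra. *)
Lemma ACp_conj p f : (1 <= p)%E -> ACp p f -> ACp p (conjf f).
Proof.
move=> p1 fp; have [cf f0 _] := (ACpP f p1).1 fp; have [aR aI] := cf.
have cc : cAC (conjf f) by split; rewrite ?reF_conj ?imF_conj//; exact: ACZ.
have [] // := @ACp_dom _ p 1 0 (conjf f) f f p1 ler01 (lexx 0) fp fp cc _ _.
  by rewrite /conjf f0 conjc0.
apply: (ae_imp _ (cAC_derivable cf)) => x [_ /derivable_is_derive dI].
rewrite mul1r mul0r addr0 /Dc reF_conj imF_conj.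
have -> : derive1 (fun t => -1 * imF f t) x = - derive1 (imF f) x.
  rewrite (_ : (fun t => _) = - imF f); last by apply/funext => t; rewrite mulN1r.
  by rewrite [LHS]derive1E; apply: derive_val.
by rewrite !normcE /= sqrrN.
Qed.

(* [(c + a) b = a] says that [1 - b] is the inverse of [c + a] up to the factor
   [c]: the algebra with a unit adjoined is inverse closed. *)
Lemma ACp_quotient p (H : R -> R) (c m : R) : (1 <= p)%E -> 0 < m ->
  (forall t, H t = H (clamp t)) -> (forall t, m <= H t) ->
  ACp p (fun x => (H (\val x) - c)%:C%C) ->
  exists2 b, ACp p b & forall x, (H (\val x))%:C%C * b x = (H (\val x) - c)%:C%C.
Proof.
move=> p1 m0 H01 mH; set a := (fun x : Icc01 R => _ : Cplx R) => ap.
have [ca a0 _] := (ACpP a p1).1 ap.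
have H0 t : 0 < H t by exact: lt_le_trans (mH t).
have aH : AC H.
  have [aR _] := ca; have -> : H = fun t => reF a t + c; last first.
    apply: ACD => //; apply: (AC_lip (K := 0)) => x y; by rewrite subrr normr0 mul0r.
  by apply/funext => t; rewrite /reF /= -H01 subrK.
pose v (x : Icc01 R) : Cplx R := (H (\val x))^-1%:C%C.
have cv : cAC v.
  split; last by apply: (AC_lip (K := 0)) => x y; rewrite /imF /= subrr normr0 mul0r.
  have -> : reF v = fun t => (H t)^-1 by apply/funext => t; rewrite /reF /= -H01.
  exact: (ACV m0 mH).
pose b := v * a.
have hb x : (H (\val x))%:C%C * b x = a x.
  rewrite /b fctE mulrA -rmorphM/= mulfV ?mul1r// gt_eqF//.
have cb : cAC b by exact: cAC_mul.
have b0 : b (clampI 0) = 0 by rewrite /b fctE a0 mulr0.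
exists b => //.
pose hh : Icc01 R -> Cplx R := (fun=> c%:C%C) + a.
have chh : cAC hh by apply: cAC_add => //; exact: cAC_cst.
have hE x : hh x = (H (\val x))%:C%C.
  by rewrite /hh fctE /a -rmorphD/= addrC subrK.
have [M M0 MP] := cAC_bounded cb.
(* Differentiating [hh * b = a], where [hh = c + a], gives hh b' = a' - a' b; now |hh| is at least
   [m] and |b| at most [M]. *)
pose K := m^-1 * (1 + M).
have K0 : 0 <= K by rewrite mulr_ge0 ?invr_ge0 ?addr_ge0// ltW.
have [] // := @ACp_dom _ p K 0 b a a p1 K0 (lexx 0) ap ap cb b0 _.
have E : hh * b = a by apply/funext => x; rewrite fctE hE hb.
have D1 := Dc_mul chh cb; rewrite E in D1.
have D2 := Dc_add (cAC_cst (c%:C%C : Cplx R)) ca.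
apply: (ae_imp2 _ D1 D2) => x; rewrite -/hh => d1 d2.
rewrite mul0r addr0 /K -mulrA ler_pdivlMl//.
apply: (@le_trans _ _ (normc (hh (clampI x) * Dc b x))).
  rewrite Normc.normcM ler_wpM2r ?normc_ge0// hE normcE /= expr0n addr0 sqrtr_sqr gtr0_norm//.
have -> : hh (clampI x) * Dc b x = Dc a x - Dc a x * b (clampI x).
  by rewrite {1}d1 d2 Dc_cst add0r addrC addKr.
rewrite mulrDl mul1r (le_trans (le_normcD _ _))// lerD2l normcN Normc.normcM mulrC.
by rewrite ler_wpM2r ?normc_ge0.
Qed.

Lemma normc_sqr_conj (z : R[i]) : (normc z ^+ 2)%:C%C = (z^*)%C * z.
Proof.
rewrite normcE sqr_sqrtr ?addr_ge0 ?sqr_ge0//; case: z => a b.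
by rewrite /GRing.mul /=; congr Complex; ring.
Qed.

Section OneCharacter.
Variables (p : \bar R) (p1 : (1 <= p)%E).
Local Notation A := (@ACp R p).
Variable phi : {ptws A -> Cplx R}.
Hypothesis phiP : max_ideal_space A phi.

Let mk f (fp : A f) : A := exist _ f (mem_set fp).
Let AP (x : A) : A (\val x). Proof. by have := valP x; rewrite inE. Qed.
Let addA (x y : A) : A := mk (proj1 (ACp_add p1 (AP x) (AP y))).
Let mulA (x y : A) : A := mk (proj1 (ACp_mul p1 (AP x) (AP y))).
Let sclA (c : R[i]) (x : A) : A := mk (proj1 (ACp_scale c p1 (AP x))).

Let phiD x y : phi (addA x y) = phi x + phi y.
Proof. by have [_ h _ _] := phiP; apply: h. Qed.
Let phiM x y : phi (mulA x y) = phi x * phi y.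
Proof. by have [_ _ _ h] := phiP; apply: h. Qed.
Let phiZ c x : phi (sclA c x) = c * phi x.
Proof. by have [_ _ h _] := phiP; apply: h. Qed.

Let iA : A := mk (inclusion01_ACp p1).
Let lam : R[i] := phi iA.

Lemma character_eval (f : A) :
  exists2 t : R, 0 <= t <= 1 & phi iA = t%:C%C /\ phi f = \val f (clampI t).
Proof.
have fp := AP f.
pose mu : R[i] := phi f; pose F := \val f.
pose fb : A := mk (ACp_conj p1 fp); pose nu := phi fb.
pose H (t : R) := normc (inclusion01 (clampI t) - lam) ^+ 2 + normc (F (clampI t) - mu) ^+ 2.
pose c : R := normc lam ^+ 2 + normc mu ^+ 2.
(* [aA] is |x - lam|^2 + |f - mu|^2 - c, expanded so as to lie in the
   algebra. *)
pose aA := addA (addA (mulA iA iA) (sclA (- (lam + (lam^*)%C)) iA))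
  (addA (addA (mulA f fb) (sclA (- (mu^*)%C) f)) (sclA (- mu) fb)).
have cE : c%:C%C = (lam^*)%C * lam + (mu^*)%C * mu.
  by rewrite /c rmorphD/= !normc_sqr_conj.
(* [nu] cancels: the term mu nu from f conj f meets - mu nu from the multiple of conj f. *)
have phia : phi aA = - c%:C%C.
  rewrite !phiD !phiM !phiZ -/lam -/mu -/nu cE; ring.
have aE : \val aA = fun x => (H (\val x) - c)%:C%C.
  apply/funext => x; rewrite /H /c clampI_val.
  transitivity (inclusion01 x * inclusion01 x + (- (lam + (lam^*)%C)) * inclusion01 x +
    (F x * (F x)^*%C + (- (mu^*)%C) * F x + (- mu) * (F x)^*%C)) => //.
  have zr : ((inclusion01 x)^*)%C = inclusion01 x by rewrite /inclusion01 conjc_real.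
  have conjB (u v : R[i]) : ((u - v)^*)%C = (u^*)%C - (v^*)%C by exact: rmorphB.
  rewrite [RHS]rmorphB/= -/c cE [X in _ = X - _]rmorphD/= !normc_sqr_conj.
  rewrite (conjB (inclusion01 x) lam) (conjB (F x) mu) zr.
  set z := inclusion01 x; set w := F x; ring.
have ap : A (fun x => (H (\val x) - c)%:C%C) by rewrite -aE; exact: AP.
have H01 t : H t = H (clamp t) by rewrite /H clampI_clamp.
have cH : continuous H.
  have [[aR _] _ _] := (ACpP _ p1).1 ap.
  have -> : H = fun t => reF (fun x => (H (\val x) - c)%:C%C) t + c.
    by apply/funext => t; rewrite /reF /= -H01 subrK.
  by move=> t; apply: cvgD; [exact: AC_continuous|exact: cvg_cst].
(* Either the minimum is 0 and is attained at the desired point, or it is the positive lower bound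
   required by [ACp_quotient]. *)
have [t0 t01 Hmin] := EVT_min ler01 (continuous_subspaceT cH).
rewrite in_itv/= in t01.
have [Ht0|Ht0] := eqVneq (H t0) 0.
  exists t0 => //; move/eqP: Ht0; rewrite /H paddr_eq0 ?sqr_ge0// !sqrf_eq0.
  move=> /andP[/eqP/Normc.eq0_normc/eqP h1 /eqP/Normc.eq0_normc/eqP h2].
  move: h1 h2; rewrite !subr_eq0 => /eqP h1 /eqP h2; split; last by rewrite -/mu -h2.
  by rewrite -/lam -h1 /inclusion01 /= clamp_id.
have m0 : 0 < H t0 by rewrite lt_neqAle eq_sym Ht0 addr_ge0 ?sqr_ge0.
have mH t : H t0 <= H t by rewrite (H01 t); apply: Hmin; rewrite in_itv/= clamp_itv.
have [b bp bE] := ACp_quotient p1 m0 H01 mH ap.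
pose bA := mk bp.
(* In c b + a b = a, the value [phi a = - c] makes the left side vanish under [phi], so c = 0 and
   both [lam] and [mu] are 0. Then [H] vanishes at 0, against its positive minimum. *)
have : phi (addA (sclA c%:C%C bA) (mulA aA bA)) = phi aA.
  congr phi; apply: val_inj; rewrite aE; apply/funext => x.
  transitivity (c%:C%C * b x + (\val aA) x * b x) => //.
  by rewrite aE -mulrDl -rmorphD/= [c + _]addrC subrK bE.
rewrite phiD phiM phiZ phia mulNr subrr => /esym/eqP; rewrite oppr_eq0 => /eqP c0.
have {c0} : c = 0 by case: c0.
move/eqP; rewrite /c paddr_eq0 ?sqr_ge0// !sqrf_eq0.
move=> /andP[/eqP/Normc.eq0_normc l0 /eqP/Normc.eq0_normc u0].
have := lt_le_trans m0 (mH 0).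
have [_ F0 _] := (ACpP _ p1).1 fp.
rewrite /H /F F0 l0 u0 !subr0 Normc.normc0 expr0n addr0.
by rewrite /inclusion01 /= clamp_id ?lexx ?ler01// !expr0n/= addr0 sqrtr0 expr0n ltxx.
Qed.

End OneCharacter.

Lemma continuous_clampI : continuous (@clampI R).
Proof.
apply: (@continuous_comp_initial _ _ _ set_val).
apply: AC_continuous; apply: (AC_lip (K := 1)) => x y.
wlog xy : x y / x <= y => [Hw|].
  by have [/Hw//|/ltW yx] := leP x y; rewrite distrC (distrC y) Hw.
rewrite mul1r !ger0_norm ?subr_ge0 ?clamp_lip//; exact: clamp_homo.
Qed.

Lemma max_ideal_space_homeomorphic p : (1 <= p)%E ->
  homeomorphic (max_ideal_space (@ACp R p)) (Ioc01 R).
Proof.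
move=> p1; set A := @ACp R p.
pose iA : A := exist _ inclusion01 (mem_set (inclusion01_ACp p1)).
have fwd (phi : max_ideal_space A) : complex.Re (\val phi iA) \in Ioc01 R.
  have phiP : max_ideal_space A (\val phi) by have := valP phi; rewrite inE.
  have [[f f0] _ _ _] := phiP.
  have [t /andP[t0 t1] [lt ft]] := character_eval p1 phiP f.
  have -> : \val phi iA = t%:C%C by rewrite -lt; congr (\val phi _); exact: val_inj.
  (* The point 0 is excluded because every element of the algebra vanishes there, while [phi f] is
     nonzero. *)
  rewrite inE /Ioc01 /= in_itv/= t1 andbT lt_neqAle t0 andbT.
  apply/eqP => t00; apply: f0; rewrite ft -t00.
  by have fA : A (\val f) by [have := valP f; rewrite inE|]; have [_ -> _] := (ACpP _ p1).1 fA.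
have bwd (t : Ioc01 R) : (fun f : A => \val f (clampI (\val t))) \in max_ideal_space A.
  have := valP t; rewrite inE /Ioc01 /= in_itv/= => /andP[t0 t1].
  rewrite inE; split.
  - have t01 : 0 <= sval t <= 1 by rewrite t1 ltW.
    exists iA; rewrite /= /inclusion01 /= (clamp_id t01).
    by move=> [] /eqP; rewrite gt_eqF.
  - by move=> f g h ->.
  - by move=> c f h ->.
  - by move=> f g h ->.
pose F (phi : max_ideal_space A) : Ioc01 R := exist _ (complex.Re (\val phi iA)) (fwd phi).
pose G (t : Ioc01 R) : max_ideal_space A :=
  exist _ ((fun f : A => \val f (clampI (\val t))) : {ptws A -> Cplx R}) (bwd t).
exists F, G; split.
- move=> phi; apply: val_inj; apply/funext => f /=.
  have phiP : max_ideal_space A (\val phi) by have := valP phi; rewrite inE.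
  (* The point obtained may a priori depend on [f], but it equals the value of the character at the
     coordinate function. *)
  have [t t01 [lt ->]] := character_eval p1 phiP f.
  have -> : \val phi iA = t%:C%C by rewrite -lt; congr (\val phi _); exact: val_inj.
  by [].
- move=> t; apply: val_inj => /=; have := valP t; rewrite inE /Ioc01 /= in_itv/= => /andP[t0 t1].
  by rewrite clamp_id// t1 ltW.
- apply: (@continuous_comp_initial _ _ _ set_val) => phi.
  apply: (@continuous_comp _ _ _ (fun phi : max_ideal_space A => \val phi iA)
    (fun z : Cplx R => complex.Re z)); last exact: continuous_Re.
  apply: (@continuous_comp _ _ _ (fun phi : max_ideal_space A => \val phi)
    (fun psi : {ptws A -> Cplx R} => psi iA)); last exact: proj_continuous.
  exact: initial_continuous.
- apply: (@continuous_comp_initial _ _ _ set_val) => t.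
  have FF : Filter ((set_val \o G) x @[x --> t]) by apply: fmap_filter; exact: nbhs_filter.
  apply/cvg_sup => f.
  apply: (@continuous_comp_initial _ _ _ (fun psi : {ptws A -> Cplx R} => psi f)
    (set_val \o G)) => s.
  have [cf _ _] : [/\ cAC (\val f), _ & _] := (ACpP _ p1).1 (set_mem (valP f)).
  apply: (@continuous_comp _ _ _ (fun t : Ioc01 R => clampI (\val t)) (\val f)).
    apply: (@continuous_comp _ _ _ (fun t : Ioc01 R => \val t) (@clampI R)).
      exact: initial_continuous.
    exact: continuous_clampI.
  exact: cAC_continuous.
Qed.

End Characters.

Theorem theorem2 (R : realType) :
  [/\ (forall p : \bar R, (1 <= p)%E ->
         is_banach_subalgebra (ACp p) (continuous_functions (Icc01 R))
           (ACp_norm p)),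
      (forall p : \bar R, (1 <= p)%E -> (p < +oo)%E ->
         has_approximate_identity (ACp p) (ACp_norm p)),
      ~ has_approximate_identity (@ACp R +oo%E) (ACp_norm +oo%E),
      (forall p : \bar R, (1 <= p)%E ->
         homeomorphic (max_ideal_space (ACp p)) (Ioc01 R))
    & (forall p r : \bar R, (1 <= p)%E -> (p < r)%E -> ACp r `<=` ACp p)].
Proof.
split; [exact: ACp_banach_subalgebra|exact: ACp_approximate_identity
  |exact: ACpy_no_approximate_identity|exact: max_ideal_space_homeomorphic|].
exact: ACp_subset.
Qed.
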